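(* In the setting described in the context (finite simple connected graph $\mathcal{G}=(V,E)$ with polynomial growth constants $d=d(\mathcal{G})$ and $D_1(\mathcal{G})$; objective $F=\sum_{i\in V}f_i$ satisfying (P1), (P2); constraint matrix ${\bf A}$ satisfying (P3); families $D_\lambda, D_{\lambda,R}$, $\lambda\in\Lambda$), consider the problem $$\min_{{\bf x}\in\mathbb{R}^N}F({\bf x})\quad\text{subject to}\quad {\bf A}{\bf x}={\bf b},$$ assumed feasible, and denote its unique minimizer by ${\bf x}^*$. Set $$\kappa=\Big(\frac{c_1+\|{\bf A}\|}{c_1}\Big)^2(L_1+\|{\bf A}\|)\max\Big(\frac1{c_1},\frac{L_1}{c_2^2}\Big)$$ and, for $R\ge 1$, $$\delta_R=D_1(\mathcal{G})\,d!\,\Big(\frac1{4m}\ln\Big(\frac{\kappa^2+1}{\kappa^2-1}\Big)\Big)^{-d}(R+2)^{d}\Big(\frac{\kappa^2-1}{\kappa^2+1}\Big)^{R/(4m)}.$$ Let ${\bf x}^{(0)}\in\mathbb{R}^N$ be arbitrary and let ${\bf x}^{(n)}$, $n\ge 0$, be generated by the divide-and-conquer iteration: for each $n\ge0$ and $\lambda\in\Lambda$, $${\bf w}_\lambda^{(n)}=\arg\min_{{\bf u}\in\mathbb{R}^{D_{\lambda,R}}}F\big(\chi^*_{D_{\lambda,R}}{\bf u}+{\bf I}_{V\setminus D_{\lambda,R}}{\bf x}^{(n)}\big)\ \ \text{s.t.}\ \ \chi_{W_{\lambda,R}}{\bf A}\big(\chi^*_{D_{\lambda,R}}{\bf u}+{\bf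 I}_{V\setminus D_{\lambda,R}}{\bf x}^{(n)}\big)=\chi_{W_{\lambda,R}}{\bf b},$$ $${\bf x}^{(n+1)}=\sum_{\lambda\in\Lambda}{\bf I}_{D_\lambda}\chi^*_{D_{\lambda,R}}{\bf w}_\lambda^{(n)}.$$ If $R\ge1$ is chosen such that $\delta_R<1$, then ${\bf x}^{(n)}$ converges to ${\bf x}^*$ exponentially in $\ell^p$ for every $1\le p\le\infty$: $$\|{\bf x}^{(n)}-{\bf x}^*\|_p\le(\delta_R)^n\|{\bf x}^{(0)}-{\bf x}^*\|_p,\qquad n\ge0.$$
   Context: Graph. $\mathcal{G}=(V,E)$ is a finite, simple, connected graph with $V=\{1,\dots,N\}$; $\rho(i,j)$ is the geodesic distance (number of edges in a shortest path), $\rho(V_1,V_2)=\inf_{i\in V_1,j\in V_2}\rho(i,j)$, and $B(i,r)=\{j\in V:\rho(i,j)\le r\}$. Polynomial growth: $d(\mathcal{G}),D_1(\mathcal{G})>0$ are constants with $\# B(i,r)\le D_1(\mathcal{G})(r+1)^{d(\mathcal{G})}$ for all $i\in V$, $r\ge0$ (the minimal such constants are called Beurling dimension and density). If $d$ is not an integer, $d!$ means $\Gamma(d+1)$. Notation. For $V_1\subseteq V$, $\chi_{V_1}:\mathbb{R}^N\to\mathbb{R}^{V_1}$ is the selection map ${\bf x}\mapsto[x_i]_{i\in V_1}$, $\chi_{V_1}^*$ is its adjoint (extension by zero), and ${\bf I}_{V_1}=\chi_{V_1}^*\chi_{V_1}$; for $V_1\subseteq W$ the same symbols $\chi_{V_1},\chi_{V_1}^*$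 are used for vectors indexed by $W$. The geodesic width $\omega({\bf B})$ of a matrix ${\bf B}=[b(i,j)]$ with rows and columns indexed by subsets of $V$ is the smallest $\omega\geq 0$ such that $b(i,j)=0$ whenever $\rho(i,j)>\omega$. $\|{\bf B}\|$ is the operator norm induced by the $\ell^2$-norms; ${\bf B}\preceq{\bf C}$ means ${\bf C}-{\bf B}$ is positive semidefinite. Objective. $F({\bf x})=\sum_{i\in V}f_i({\bf x})$, ${\bf x}\in\mathbb{R}^N$. (P1) Each $f_i:\mathbb{R}^N\to\mathbb{R}$ is continuously differentiable and depends only on $x_j$, $j\in B(i,m)$, where $m\ge1$ is an integer. (P2) There are constants $0<c_1<L_1<\infty$ and (symmetric) positive definite matrices ${\bf J}({\bf x},{\bf y})$, ${\bf x},{\bf y}\in\mathbb{R}^N$, such that $\omega({\bf J}({\bf x},{\bf y}))\le 2m$, $c_1{\bf I}\preceq{\bf J}({\bf x},{\bf y})\preceq L_1{\bf I}$ and $\nabla F({\bf x})-\nabla F({\bf y})={\bf J}({\bf x},{\bf y})({\bf x}-{\bf y})$ for all ${\bf x},{\bf y}\in\mathbb{R}^N$. Regions. $\Lambda\subseteq V$ is a set of fusion centers; $D_\lambda\subseteq V$, $\lambda\in\Lambda$, are pairwise disjoint with union $V$; for the given $R$, $D_{\lambda,R}\subseteq V$ satisfy $D_\lambda\subseteq D_{\lambda,R}$ and $\rho(D_\lambda,V\setminus D_{\lambda,R})>R$ for all $\lambda\in\Lambda$. Constraints. $W\subseteq V$, ${\bf A}=[a(k,j)]_{k\in W,j\in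 V}$ is a real matrix, ${\bf b}\in\mathbb{R}^W$, and $W_{\lambda,R}=\{k\in W: a(k,j)\ne0\text{ for some }j\in D_{\lambda,R}\}$. (P3) $\omega({\bf A})\le2m$, and there is a constant $c_2>0$ such that ${\bf A}_{\lambda,R}{\bf A}_{\lambda,R}^T\succeq c_2^2\,{\bf I}$ for all $\lambda\in\Lambda$, where ${\bf A}_{\lambda,R}=[a(k,j)]_{k\in W_{\lambda,R},j\in D_{\lambda,R}}$. *)

(* Defs.v *)
From HB Require Import structures.
From mathcomp Require Import all_boot all_order all_algebra.
From mathcomp Require Import all_classical all_reals all_analysis.
Import Order.TTheory GRing.Theory Num.Theory.
Import numFieldNormedType.Exports.
Set Implicit Arguments.
Unset Strict Implicit.
Unset Printing Implicit Defensive.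
Local Open Scope ring_scope.

Definition simple_graph (V : finType) (e : rel V) : Prop :=
  symmetric e /\ irreflexive e.

Definition connected_graph (V : finType) (e : rel V) : Prop :=
  forall i j, connect e i j.

(* Least length of a walk from i to j.  Shortest walks have length < #|V|, so
   the bounded search loses nothing; the default value #|V| is returned only
   when there is no walk at all. *)
Definition gdist (V : finType) (e : rel V) (i j : V) : nat :=
  \big[minn/#|V|]_(n < #|V| |
      [exists p : n.-tuple V, path e i p && (last i p == j)]) n.

(* inf over the empty set is +oo *)
Definition gdist_set (R : realType) (V : finType) (e : rel V)
    (V1 V2 : {set V}) : \bar R :=
  ereal_inf [set z | exists i j,
    [/\ i \in V1, j \in V2 & z = (gdist e i j)%:R%:E]]%classic.

Definition gball (R : realType) (V : finType) (e : rel V) (i : V) (r : R) :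
    {set V} :=
  [set j | (gdist e i j)%:R <= r].

Definition polynomial_growth (R : realType) (V : finType) (e : rel V)
    (d D1 : R) : Prop :=
  forall (i : V) (r : R), 0 <= r -> #|gball e i r|%:R <= D1 * (r + 1) `^ d.

(* Rows and columns of B are labelled by the vertices rI k and cI l. *)
Definition gwidth (R : realType) (V : finType) (e : rel V) (p q : nat)
    (rI : 'I_p -> V) (cI : 'I_q -> V) (B : 'M[R]_(p, q)) : R :=
  inf [set w | 0 <= w /\
    forall k l, w < (gdist e (rI k) (cI l))%:R -> B k l = 0]%classic.

(* Vectors indexed by a subset D are column vectors of length #|D|, the k-th
   entry being the one of index (enum_val k); chi D is the matrix of the
   selection map and (chi D)^T that of its adjoint, extension by zero. *)
Definition chi (R : realType) (n : nat) (D : {set 'I_n}) : 'M[R]_(#|D|, n) :=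
  \matrix_(k, j) (enum_val k == j)%:R.

Definition Iproj (R : realType) (n : nat) (D : {set 'I_n}) : 'M[R]_n :=
  (chi R D)^T *m chi R D.

Definition submat (R : realType) (p q : nat) (A : 'M[R]_(p, q))
    (K : {set 'I_p}) (D : {set 'I_q}) : 'M[R]_(#|K|, #|D|) :=
  \matrix_(k, l) A (enum_val k) (enum_val l).

Definition row_support (R : realType) (p q : nat) (A : 'M[R]_(p, q))
    (D : {set 'I_q}) : {set 'I_p} :=
  [set k | [exists j in D, A k j != 0]].

Definition possemidefmx (R : realType) (n : nat) (B : 'M[R]_n) : Prop :=
  B^T = B /\ forall v : 'cV[R]_n, 0 <= (v^T *m B *m v) 0 0.

Definition posdefmx (R : realType) (n : nat) (B : 'M[R]_n) : Prop :=
  B^T = B /\ forall v : 'cV[R]_n, v != 0 -> 0 < (v^T *m B *m v) 0 0.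

Definition lowner_le (R : realType) (n : nat) (B C : 'M[R]_n) : Prop :=
  possemidefmx (C - B).

Definition lpnorm (R : realType) (n : nat) (p : \bar R) (x : 'cV[R]_n) : R :=
  match p with
  | (r%:E)%E => (\sum_i `|x i 0| `^ r) `^ r^-1
  | +oo%E => \big[Num.max/0]_i `|x i 0|
  | -oo%E => 0
  end.

Definition opnorm (R : realType) (p q : nat) (A : 'M[R]_(p, q)) : R :=
  sup [set lpnorm 2%:E (A *m x) | x in
    [set x : 'cV[R]_q | lpnorm 2%:E x <= 1]]%classic.

Definition gradient (R : realType) (n : nat) (f : 'cV[R]_n -> R)
    (x : 'cV[R]_n) : 'cV[R]_n :=
  \col_j 'D_(delta_mx j 0) f x.

Definition continuously_differentiable (R : realType) (n : nat)
    (f : 'cV[R]_n -> R) : Prop :=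
  (forall x, differentiable f x) /\ continuous (gradient f).

Definition is_argmin (R : realType) (T : Type) (C : set T) (F : T -> R)
    (x : T) : Prop :=
  C x /\ forall y, C y -> F x <= F y.

Definition Gamma (R : realType) (s : R) : R :=
  Rintegral (@lebesgue_measure R) `]0, +oo[%classic
    (fun t => t `^ (s - 1) * expR (- t)).

(* d! for real d > 0; for natural d this is the usual factorial. *)
Definition rfact (R : realType) (d : R) : R := Gamma (d + 1).

Definition kappa (R : realType) (c1 L1 c2 normA : R) : R :=
  ((c1 + normA) / c1) ^+ 2 * (L1 + normA) * Num.max (1 / c1) (L1 / c2 ^+ 2).

Definition delta (R : realType) (d D1 : R) (m : nat) (k r : R) : R :=
  D1 * rfact d
  * (1 / (4 * m%:R) * ln ((k ^+ 2 + 1) / (k ^+ 2 - 1))) `^ (- d)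
  * (r + 2) `^ d
  * ((k ^+ 2 - 1) / (k ^+ 2 + 1)) `^ (r / (4 * m%:R)).

(* Main.v *)
Require Import Defs.
From HB Require Import structures.
From mathcomp Require Import all_boot all_order all_algebra.
From mathcomp Require Import all_classical all_reals all_analysis.
From mathcomp Require Import measurable_realfun.
From mathcomp Require Import ring lra zify.
Import Order.TTheory GRing.Theory Num.Theory.
Import numFieldNormedType.Exports.
Set Implicit Arguments.
Unset Strict Implicit.
Unset Printing Implicit Defensive.
Local Open Scope ring_scope.

(* At a vertex [i] of [D l] the new error is the restriction to the region [DR l]
   of the solution of a linear system: subtracting the first-order conditions of
   the local and of the global problem, the local error solves the KKT system
   with matrix [[J_DR, A_l^T], [A_l, 0]] and a right-hand side that only sees the
   old error outside [DR l].  So it suffices to bound the solution at distance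
   [rho > r] from a point source by [exp (- t (rho + 1))], where
   [q = (k^2 - 1) / (k^2 + 1) = exp (- 4 m t)]; a Schur test then gives every
   [l^p] norm, the row sums being at most [delta] by comparing the tail sum over
   the graph with the Gamma integral.

   The matrix has width [2 m] and condition number at most [k], and polynomials
   of degree [n] in it have width [2 m n].  If no constraint meets [DR l] the
   matrix is positive definite and a Neumann series decays at the rate
   [(k - 1) / (k + 1)].  Otherwise [k >= 6], and a degree 2 Chebyshev polynomial
   of the squared matrix decays fast enough.  In both cases the multiplicative
   constant is absorbed because [delta < 1] forces [r] to be of order [k^2 m]: the
   ball of radius [r + 1] has more than [r + 1] vertices, whence
   [exp (t (r + 1)) >= r + 1]. *)

(** * Euclidean norm *)

Section Euclidean.
Context {R : realType}.

Definition dot n (u v : 'cV[R]_n) : R := (u^T *m v) 0 0.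
Definition enorm n (u : 'cV[R]_n) : R := Num.sqrt (dot u u).

Lemma dotE n (u v : 'cV[R]_n) : dot u v = \sum_i u i 0 * v i 0.
Proof. by rewrite /dot mxE; apply: eq_bigr => i _; rewrite mxE. Qed.

Lemma dotC n (u v : 'cV[R]_n) : dot u v = dot v u.
Proof. by rewrite !dotE; apply: eq_bigr => i _; rewrite mulrC. Qed.

Lemma dotDl n (u v w : 'cV[R]_n) : dot (u + v) w = dot u w + dot v w.
Proof. by rewrite /dot linearD mulmxDl mxE. Qed.

Lemma dotDr n (u v w : 'cV[R]_n) : dot w (u + v) = dot w u + dot w v.
Proof. by rewrite /dot mulmxDr mxE. Qed.

Lemma dotZl n a (u v : 'cV[R]_n) : dot (a *: u) v = a * dot u v.
Proof. by rewrite /dot linearZ -scalemxAl mxE. Qed.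

Lemma dotZr n a (u v : 'cV[R]_n) : dot u (a *: v) = a * dot u v.
Proof. by rewrite /dot -scalemxAr mxE. Qed.

Lemma dotNl n (u v : 'cV[R]_n) : dot (- u) v = - dot u v.
Proof. by rewrite -scaleN1r dotZl mulN1r. Qed.

Lemma dotNr n (u v : 'cV[R]_n) : dot u (- v) = - dot u v.
Proof. by rewrite -scaleN1r dotZr mulN1r. Qed.

Lemma dotBl n (u v w : 'cV[R]_n) : dot (u - v) w = dot u w - dot v w.
Proof. by rewrite dotDl dotNl. Qed.

Lemma dotBr n (u v w : 'cV[R]_n) : dot w (u - v) = dot w u - dot w v.
Proof. by rewrite dotDr dotNr. Qed.

Lemma dot_mul p q (B : 'M[R]_(p, q)) u v : dot (B *m u) v = dot u (B^T *m v).
Proof. by rewrite /dot trmx_mul mulmxA. Qed.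

Lemma dot_ge0 n (u : 'cV[R]_n) : 0 <= dot u u.
Proof. by rewrite dotE sumr_ge0 // => i _; rewrite -expr2 sqr_ge0. Qed.

Lemma dot_eq0 n (u : 'cV[R]_n) : dot u u = 0 -> u = 0.
Proof.
rewrite dotE => /eqP; rewrite psumr_eq0 => [/allP u0|i _]; last first.
  by rewrite -expr2 sqr_ge0.
apply/matrixP => i j; rewrite ord1 mxE; apply/eqP.
by have := u0 i (mem_index_enum i); rewrite /= mulf_eq0 orbb.
Qed.

Lemma enorm_ge0 n (u : 'cV[R]_n) : 0 <= enorm u.
Proof. exact: sqrtr_ge0. Qed.

Lemma sqr_enorm n (u : 'cV[R]_n) : enorm u ^+ 2 = dot u u.
Proof. by rewrite sqr_sqrtr // dot_ge0. Qed.

Lemma enorm0 n : enorm (0 : 'cV[R]_n) = 0.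
Proof. by rewrite /enorm /dot mulmx0 mxE sqrtr0. Qed.

Lemma enorm_eq0 n (u : 'cV[R]_n) : enorm u = 0 -> u = 0.
Proof. by move=> u0; apply: dot_eq0; rewrite -sqr_enorm u0 expr0n. Qed.

Lemma enormZ n a (u : 'cV[R]_n) : enorm (a *: u) = `|a| * enorm u.
Proof. by rewrite /enorm dotZl dotZr mulrA sqrtrM ?sqrtr_sqr // -expr2 sqr_ge0. Qed.

Lemma enormN n (u : 'cV[R]_n) : enorm (- u) = enorm u.
Proof. by rewrite /enorm dotNl dotNr opprK. Qed.

Lemma enorm_le p q (u : 'cV[R]_p) (v : 'cV[R]_q) c :
  0 <= c -> dot u u <= c ^+ 2 * dot v v -> enorm u <= c * enorm v.
Proof.
move=> c0 h; rewrite -(@ler_pXn2r _ 2) ?nnegrE ?mulr_ge0 ?enorm_ge0 //.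
by rewrite exprMn !sqr_enorm.
Qed.

Lemma dot_le_of_enorm_le p q (u : 'cV[R]_p) (v : 'cV[R]_q) c :
  0 <= c -> enorm u <= c * enorm v -> dot u u <= c ^+ 2 * dot v v.
Proof.
move=> c0; rewrite -(@ler_pXn2r _ 2) ?nnegrE ?mulr_ge0 ?enorm_ge0 //.
by rewrite exprMn !sqr_enorm.
Qed.

(** The squared norm of [dot v v *: u - dot u v *: v] is [dot v v] times the difference of the
    squared sides. *)
Lemma dot_CS n (u v : 'cV[R]_n) : `|dot u v| <= enorm u * enorm v.
Proof.
rewrite -(@ler_pXn2r _ 2) ?nnegrE ?mulr_ge0 ?enorm_ge0 //.
rewrite exprMn !sqr_enorm real_normK ?num_real //.
have [/eqP v0|v0] := boolP (dot v v == 0).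
  by rewrite (dot_eq0 v0) /dot !mulmx0 !mxE expr0n mulr0.
have v1 : 0 < dot v v by rewrite lt_neqAle eq_sym v0 dot_ge0.
have := dot_ge0 (dot v v *: u - dot u v *: v).
rewrite !dotBl !dotBr !dotZl !dotZr (dotC v u).
set a := dot u u; set b := dot v v in v1 *; set c := dot u v.
have -> : b * (b * a) - b * (c * c) - (c * (b * c) - c * (c * b)) = b * (a * b - c ^+ 2).
  by ring.
by rewrite pmulr_rge0 // subr_ge0.
Qed.

Lemma enormD n (u v : 'cV[R]_n) : enorm (u + v) <= enorm u + enorm v.
Proof.
rewrite -(@ler_pXn2r _ 2) ?nnegrE ?addr_ge0 ?enorm_ge0 //.
rewrite sqr_enorm dotDl !dotDr (dotC v u) sqrrD !sqr_enorm.
have := le_trans (ler_norm _) (dot_CS u v); lra.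
Qed.

Lemma enormB n (u v : 'cV[R]_n) : enorm (u - v) <= enorm u + enorm v.
Proof. by apply: le_trans (enormD _ _) _; rewrite enormN. Qed.

Lemma entry_le_enorm n (u : 'cV[R]_n) i : `|u i 0| <= enorm u.
Proof.
rewrite -(@ler_pXn2r _ 2) ?nnegrE ?enorm_ge0 //.
rewrite sqr_enorm dotE (bigD1 i) //= real_normK ?num_real // -expr2 lerDl.
by rewrite sumr_ge0 // => j _; rewrite -expr2 sqr_ge0.
Qed.

Lemma dot_col_mx p q (u : 'cV[R]_p) (v : 'cV[R]_q) :
  dot (col_mx u v) (col_mx u v) = dot u u + dot v v.
Proof.
rewrite !dotE big_split_ord /=; congr (_ + _); apply: eq_bigr => i _.
  by rewrite col_mxEu.
by rewrite col_mxEd.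
Qed.

(* By polarisation. *)
Lemma sym_enorm_le n (S : 'M[R]_n) c : 0 <= c -> S^T = S ->
  (forall u, `|dot u (S *m u)| <= c * dot u u) ->
  forall u, enorm (S *m u) <= c * enorm u.
Proof.
move=> c0 Ssym Sc u.
have key x y : 2 * dot x (S *m y) <= c * (dot x x + dot y y).
  have h1 := ler_normlW (Sc (x + y)).
  have := Sc (x - y); rewrite ler_norml => /andP[h2 _].
  have sw : dot y (S *m x) = dot x (S *m y) by rewrite dotC dot_mul Ssym.
  move: h1 h2; rewrite !mulmxDr !mulmxN !dotDl !dotDr !dotNl !dotNr sw (dotC y x); lra.
have [/eqP u0|u0] := boolP (enorm (S *m u) == 0).
  by rewrite u0 mulr_ge0 // enorm_ge0.
have Su : 0 < enorm (S *m u) by rewrite lt_neqAle eq_sym u0 enorm_ge0.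
have [/eqP eu|eu] := boolP (enorm u == 0).
  by move: Su; rewrite (enorm_eq0 eu) mulmx0 enorm0 ltxx.
have u1 : 0 < enorm u by rewrite lt_neqAle eq_sym eu enorm_ge0.
(* Rescaling [S *m u] to the norm of [u] balances the two squares on the right of [key]. *)
have := key ((enorm u / enorm (S *m u)) *: (S *m u)) u.
rewrite !dotZl !dotZr -!sqr_enorm.
set a := enorm u in u1 *; set b := enorm _ in Su *.
have -> : 2 * (a / b * b ^+ 2) = (2 * a) * b by field; rewrite gt_eqF.
have -> : c * (a / b * (a / b * b ^+ 2) + a ^+ 2) = (2 * a) * (c * a).
  by field; rewrite gt_eqF.
by rewrite ler_pM2l // mulr_gt0.
Qed.

End Euclidean.

(** * Graph distance *)

Section GraphDistance.
Context (V : finType) (e : rel V).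

Lemma gdist_le_size (i : V) (p : seq V) :
  path e i p -> (gdist e i (last i p) <= size p)%N.
Proof.
move=> ep; rewrite /gdist.
have [ps|ps] := ltnP (size p) #|V|.
  apply: (@bigmin_le_cond _ nat _ #|V| (Ordinal ps)
    (fun n : 'I_#|V| => [exists q : n.-tuple V, path e i q && (last i q == last i p)])
    (fun n => n)).
  by apply/existsP; exists (in_tuple p); rewrite ep eqxx.
(* A walk this long is outside the bounded search, but the default value [#|V|] already bounds the
   minimum. *)
by apply: leq_trans ps; apply: (@bigmin_le_id _ nat).
Qed.

Hypothesis e_conn : connected_graph e.

(** Shortening a connecting path to one without repetition brings its length below [#|V|], so the
    minimum is attained by a walk and is not the default value. *)
Lemma gdist_pathP (i j : V) :
  exists2 p, path e i p & last i p = j /\ size p = gdist e i j.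
Proof.
have /connectP[q0 eq0 ->] := e_conn i j.
have [q eq uq _] := shortenP eq0.
have qs : (size q < #|V|)%N.
  by rewrite -[(size q).+1]/(size (i :: q)) -(card_uniqP uq) max_card.
set P := fun n : 'I_#|V| =>
  [exists r : n.-tuple V, path e i r && (last i r == last i q)].
have Pq : P (Ordinal qs).
  by apply/existsP; exists (in_tuple q); rewrite eq eqxx.
have [n /existsP[r /andP[er /eqP lr]] nE] :=
  @eq_bigmin _ nat _ #|V| (Ordinal qs) P (fun n => n : nat) Pq
    (fun n _ => ltnW (ltn_ord n)).
by exists r => //; split => //; rewrite size_tuple /gdist nE.
Qed.

Lemma gdist_triangle (i j k : V) : (gdist e i k <= gdist e i j + gdist e j k)%N.
Proof.
have [p ep [lp <-]] := gdist_pathP i j.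
have [q eq [<- <-]] := gdist_pathP j k.
rewrite -lp in eq *; rewrite -size_cat -last_cat; apply: gdist_le_size.
by rewrite cat_path ep eq.
Qed.

Lemma gdistC : symmetric e -> forall i j : V, gdist e i j = gdist e j i.
Proof.
move=> esym i j; wlog suff h : i j / (gdist e i j <= gdist e j i)%N.
  by apply/eqP; rewrite eqn_leq !h.
have [p ep [<- <-]] := gdist_pathP j i.
have er : path e (last j p) (rev (belast j p)).
  have h : (fun z => e^~ z) =2 e by move=> x y; exact: esym.
  by rewrite rev_path (eq_path h).
have := gdist_le_size er; rewrite size_rev size_belast.
by case: p {ep er} => [|x p] /=; rewrite ?rev_cons ?last_rcons.
Qed.

(** The vertex reached after [l] steps of a shortest path works: by the triangle inequality it
    cannot be closer. *)
Lemma gdist_sphere (i j : V) (l : nat) :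
  (l <= gdist e i j)%N -> exists v, gdist e i v = l.
Proof.
have [p ep [lp sp]] := gdist_pathP i j => hl.
move: ep; rewrite -{1}(cat_take_drop l p) cat_path => /andP[e1 e2].
exists (last i (take l p)); apply/eqP; rewrite eqn_leq.
have h1 := gdist_le_size e1; have h2 := gdist_le_size e2.
have := gdist_triangle i (last i (take l p)) j.
move: h1 h2; rewrite -last_cat cat_take_drop lp size_drop sp size_takel ?sp //.
lia.
Qed.

(** The spheres of radius [0, ..., k] are non-empty and disjoint. This count later turns [delta < 1]
    into a lower bound on the radius. *)
Lemma card_ball_gt (i j : V) (k : nat) :
  (k <= gdist e i j)%N -> (k < #|[set v | gdist e i v <= k]|)%N.
Proof.
move=> hk.
have hs (l : 'I_k.+1) : exists v, gdist e i v == l.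
  have [v hv] := @gdist_sphere i j l (leq_trans (leq_ord l) hk).
  by exists v; apply/eqP.
pose g l := xchoose (hs l).
have gE l : gdist e i (g l) = l by apply/eqP/(xchooseP (hs l)).
have ginj : injective g by move=> l l' /(congr1 (gdist e i)); rewrite !gE => /val_inj.
rewrite -[k.+1]card_ord -(card_imset _ ginj); apply/subset_leq_card/fintype.subsetP => v.
by case/imsetP => l _ ->; rewrite inE gE leq_ord.
Qed.

End GraphDistance.

(** * Tail sums and the Gamma function *)

Section GammaTail.
Context {R : realType}.
Local Notation mu := (@lebesgue_measure R).

Lemma integral_expRN (c a : R) : 0 < c ->
  (\int[mu]_(x in `[a, +oo[) (c * expR (- c * x))%:E = (expR (- c * a))%:E)%E.
Proof.
move=> c0.
have cont : continuous (fun x : R^o => expR (- c * x)).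
  move=> z; apply: continuous_comp; last exact: continuous_expR.
  by apply: continuousM => //; apply: (@continuousN _ R^o); exact: cst_continuous.
have cont2 : continuous (fun x : R^o => c * expR (- c * x)).
  move=> z.
  exact: (@continuousM R R^o (fun=> c) (fun x => expR (- c * x)) z
    (@cst_continuous _ _ c z) (cont z)).
rewrite (@ge0_continuous_FTC2y _ _ (fun x => - expR (- c * x)) a 0).
- by rewrite sub0e EFinN oppeK.
- by move=> x _; rewrite mulr_ge0 ?expR_ge0 // ltW.
- exact: (@continuous_subspaceT R^o _ _ _ cont2).
- rewrite -oppr0; apply: cvgN.
  rewrite (_ : (fun x => expR (- c * x)) =
               (fun z => expR (- z)) \o (fun z => c * z)); last first.
    by apply: funext => x /=; rewrite mulNr.
  apply: (@cvg_comp _ _ _ _ _ _ (pinfty_nbhs R)); last exact: cvgr_expR.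
  exact: gt0_cvgMry.
- by move=> x _; exact: ex_derive.
- by apply: cvgN; apply/cvg_at_right_filter; exact: cont.
move=> z _; rewrite derive1_comp// derive1N// derive1_id mulN1r derive1_comp// derive1E.
have /funeqP -> := @derive_expR R.
by rewrite derive1Ml// derive1_id mulr1 mulrN opprK mulrC.
Qed.

(** For [y > 1] a single Taylor term of [expR (y / 2)], of integer degree above [d], suffices; the
    summand 1 of the constant handles [y <= 1]. *)
Lemma powR_le_expR (d : R) : 0 < d ->
  exists2 C, 0 < C & forall y : R, 0 <= y -> y `^ d <= C * expR (y / 2).
Proof.
move=> d0; pose n := Num.truncn d.
have dn : d < n.+1%:R by rewrite truncnS_gt.
exists (1 + 2 ^+ n.+1 * n.+1`!%:R).
  by rewrite ltr_pwDl // mulr_ge0 // exprn_ge0.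
move=> y y0; rewrite mulrDl mul1r.
have e1 : 1 <= expR (y / 2) by rewrite -expR0 ler_expR divr_ge0.
have [y1|y1] := lerP y 1.
  apply: le_trans (_ : 1 <= _).
    have -> : (1 : R) = 1 `^ d by rewrite powR1.
    by apply: ge0_ler_powR; rewrite ?nnegrE // ltW.
  by rewrite (le_trans e1) // lerDl mulr_ge0 ?expR_ge0 // mulr_ge0 // exprn_ge0.
apply: le_trans (_ : y ^+ n.+1 <= _).
  by rewrite -powR_mulrn // ler_powR // ltW.
have h := @expR_ge1Dxn _ (y / 2) n (divr_ge0 y0 (ler0n _ 2)).
have f0 : (0 : R) < n.+1`!%:R by rewrite ltr0n fact_gt0.
have p0 : (0 : R) < 2 ^+ n.+1 by rewrite exprn_gt0.
have -> : y ^+ n.+1 = 2 ^+ n.+1 * n.+1`!%:R * ((y / 2) ^+ n.+1 / n.+1`!%:R).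
  by rewrite exprMn exprVn; field; rewrite !gt_eqF.
rewrite -[leLHS]add0r lerD ?expR_ge0 // ler_wpM2l ?mulr_ge0 ?(ltW p0) ?(ltW f0) //.
by apply: le_trans h; rewrite lerDr.
Qed.

(** Dominated by a multiple of [expR (- y / 2)]. The exponent [d + 1 - 1] is the form in which
    [rfact d] unfolds. *)
Lemma integrable_Gamma (d : R) : 0 < d ->
  mu.-integrable `]0, +oo[ (fun y => (y `^ (d + 1 - 1) * expR (- y))%:E).
Proof.
move=> d0; rewrite addrK; have [C C0 hC] := powR_le_expR d0.
apply: (@le_integrable _ _ R mu _ _ _ (fun y : R => (C * 2)%:E * (2^-1 * expR (- 2^-1 * y))%:E)%E).
- by [].
- apply/measurable_EFinP; apply: measurable_funM.
    exact: measurable_funTS (measurable_powR d).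
  exact: (@measurableT_comp _ _ _ _ _ _ expR).
- move=> y /=; rewrite in_itv /= andbT => y0.
  rewrite lee_fin ger0_norm ?mulr_ge0 ?powR_ge0 ?expR_ge0 //.
  rewrite ger0_norm ?mulr_ge0 ?invr_ge0 ?expR_ge0 ?(ltW C0) //.
  have -> : C * 2 * (2^-1 * expR (- 2^-1 * y)) = C * expR (y / 2) * expR (- y).
    have -> : - 2^-1 * y = y / 2 - y by field.
    by rewrite expRD; field.
  by rewrite ler_wpM2r ?expR_ge0 // hC // ltW.
apply: integrableZl => //; apply/integrableP; split.
  apply/measurable_EFinP; apply: measurable_funM => //.
  exact: (@measurableT_comp _ _ _ _ _ _ expR).
under eq_integral do rewrite /= ger0_norm ?mulr_ge0 ?invr_ge0 ?expR_ge0 //.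
rewrite integral_itv_obnd_cbnd; last first.
  apply/measurable_EFinP; apply: measurable_funM => //.
  exact: (@measurableT_comp _ _ _ _ _ _ expR).
by rewrite integral_expRN ?invr_gt0 // ltry.
Qed.

Lemma rfact_ge0 (d : R) : 0 <= rfact d.
Proof.
rewrite /rfact /Gamma; apply: fine_ge0; apply: integral_ge0 => y _.
by rewrite lee_fin mulr_ge0 ?powR_ge0 ?expR_ge0.
Qed.

Lemma rfactE (d : R) : 0 < d ->
  ((rfact d)%:E = \int[mu]_(y in `]0%R, +oo[) (y `^ d * expR (- y))%:E)%E.
Proof.
move=> d0; rewrite /rfact /Gamma /Rintegral fineK ?addrK //.
by have := integrable_fin_num _ (integrable_Gamma d0); rewrite addrK; exact.
Qed.

(* exp (- a) is the integral of exp (- y) over y >= a; summing over the vertices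
   exchanges the sum of exponentials for the integral of a ball count, and the
   growth hypothesis turns the latter into the Gamma integral. *)
Lemma ball_expR_sum (V : finType) (e : rel V) (d D1 t : R) (i : V) (k : nat) :
  0 < d -> 0 < D1 -> 0 < t -> polynomial_growth e d D1 ->
  \sum_j expR (- t * (maxn (gdist e i j) k.+1)%:R) <=
  expR (- t * k%:R) * (D1 * rfact d * t `^ (- d) * k.+2%:R `^ d).
Proof.
move=> d0 D0 t0 growth.
pose a j := t * ((maxn (gdist e i j) k.+1)%:R - k%:R).
have ta j : t <= a j.
  by rewrite /a -{1}(mulr1 t) ler_pM2l // lerBrDr nat1r ler_nat leq_maxr.
have aE j : expR (- t * (maxn (gdist e i j) k.+1)%:R) = expR (- t * k%:R) * expR (- a j).
  by rewrite -expRD /a; congr expR; ring.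
under eq_bigr do rewrite aE.
rewrite -mulr_sumr ler_wpM2l ?expR_ge0 // -lee_fin.
have -> : ((D1 * rfact d * t `^ (- d) * k.+2%:R `^ d)%:E =
  \int[mu]_(y in `]0%R, +oo[) ((D1 * t `^ (- d) * k.+2%:R `^ d)%:E * (y `^ d * expR (- y))%:E))%E.
  rewrite integralZl //; last by have := integrable_Gamma d0; rewrite addrK.
  by rewrite -rfactE // -EFinM; congr EFin; ring.
have mexp : measurable_fun [set: R] (fun y : R => expR (- y)).
  exact: (@measurableT_comp _ _ _ _ _ _ expR).
have -> : ((\sum_j expR (- a j))%:E =
  \int[mu]_(y in `]0%R, +oo[) (\sum_j (((fun y => (expR (- y))%:E) \_ `[a j, +oo[) y)))%E.
  rewrite ge0_integral_sum //.
  - rewrite -sumEFin; apply: eq_bigr => j _.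
    rewrite -integral_mkcondr (_ : _ `&` _ = `[a j, +oo[)%classic; last first.
      apply/seteqP; split => y /=; rewrite !in_itv /= !andbT; first by case.
      by move=> h; split => //; apply: lt_le_trans (lt_le_trans t0 (ta j)) h.
    have := integral_expRN (a j) (@ltr01 R); rewrite mulN1r => <-.
    by apply: eq_integral => y _; rewrite mul1r mulN1r.
  - move=> j; apply: measurable_funTS; apply/measurable_restrict => //.
    by apply: measurable_funTS; apply/measurable_EFinP.
  - by move=> j y _; apply: erestrict_ge0 => z _; rewrite lee_fin expR_ge0.
apply: ge0_le_integral => //.
- by move=> y _; apply: sume_ge0 => j _; apply: erestrict_ge0 => z _; rewrite lee_fin expR_ge0.
- apply: emeasurable_sum => j; apply: measurable_funTS; apply/measurable_restrict => //.
  by apply: measurable_funTS; apply/measurable_EFinP.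
- apply/measurable_EFinP; apply: measurable_funM => //; apply: measurable_funM.
    exact: measurable_funTS (measurable_powR d).
  exact: measurable_funTS.
move=> y /=; rewrite in_itv /= andbT => y0.
have -> : (\sum_j ((fun y => (expR (- y))%:E) \_ `[a j, +oo[) y)%E =
    ((#|[set j | a j <= y]|%:R : R) * expR (- y))%:E.
  rewrite -sum1_card natr_sum mulr_suml -sumEFin [RHS]big_mkcond /=.
  apply: eq_bigr => j _; rewrite patchE inE; case: ifPn => [|].
    by rewrite inE /= in_itv /= andbT => ->; rewrite mul1r.
  by rewrite notin_setE /= in_itv /= andbT => /negP/negbTE ->.
rewrite lee_fin mulrA ler_wpM2r ?expR_ge0 //.
(* Every [a j] is at least [t], so no vertex is counted when [y < t]. *)
have [yt|ty] := ltrP y t.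
  rewrite (_ : [set j | a j <= y] = finset.set0) ?cards0; last first.
    apply/setP => j; rewrite !inE; apply/negbTE; rewrite -ltNge.
    exact: lt_le_trans yt (ta j).
  by rewrite !mulr_ge0 ?powR_ge0 // ltW.
(* The vertices counted lie in the ball of radius [y / t + k], and [y / t >= 1] gives
   [y / t + k + 1 <= (k + 2) (y / t)], which separates [k] from [y]. *)
have y_t : 1 <= y / t by rewrite ler_pdivlMr // mul1r.
have q0 : 0 <= y / t + k%:R by rewrite addr_ge0 // (le_trans _ y_t).
apply: le_trans (_ : _ <= #|gball e i (y / t + k%:R)|%:R) _.
  rewrite ler_nat; apply/subset_leq_card/fintype.subsetP => j; rewrite !inE /a => h.
  rewrite -lerBlDr ler_pdivlMr // mulrC; apply: le_trans h.
  by rewrite ler_pM2l // lerD2r ler_nat leq_maxl.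
apply: le_trans (growth i _ q0) _.
rewrite -!mulrA ler_pM2l // powRN.
have -> : (t `^ d)^-1 * (k.+2%:R `^ d * y `^ d) = (k.+2%:R * (y / t)) `^ d.
  rewrite powRM ?ler0n ?(le_trans _ y_t) // powRM ?invr_ge0 ?(ltW y0) ?(ltW t0) //.
  have -> : t^-1 `^ d = (t `^ d)^-1.
    by rewrite -[t^-1]powR_inv1 ?(ltW t0) // -powRrM mulN1r powRN.
  by ring.
apply: ge0_ler_powR; rewrite ?nnegrE ?(ltW d0) ?addr_ge0 ?mulr_ge0 ?invr_ge0 ?(ltW y0) ?(ltW t0) //.
rewrite -addn2 natrD mulrDl.
have := ler_wpM2l (ler0n R k) y_t; lra.
Qed.

End GammaTail.

(** * Schur test *)

Section SchurTest.
Context {R : realType}.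

(** Young's inequality for the product of [y] and 1 with exponents [p] and [p / (p - 1)]; [p = 1]
    has no finite conjugate and is separate. *)
Lemma powR_bernoulli (p y : R) : 1 <= p -> 0 <= y -> 1 + p * (y - 1) <= y `^ p.
Proof.
rewrite le_eqVlt => /predU1P[<- y0|p1 y0]; first by rewrite powRr1 // mul1r; lra.
have p0 : 0 < p by exact: lt_trans p1.
have q0 : 0 < p / (p - 1) by rewrite divr_gt0 // subr_gt0.
have pq : p^-1 + (p / (p - 1))^-1 = 1.
  by field; rewrite !gt_eqF // subr_gt0.
have := conjugate_powR y0 (@ler01 R) p0 q0 pq.
rewrite powR1 mulr1 div1r invf_div => h.
have : y * p <= y `^ p + (p - 1).
  have := ler_wpM2r (ltW p0) h.
  by rewrite mulrDl !divfK ?gt_eqF.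
lra.
Qed.

(** Jensen's inequality for weights of total at most [s]: each [a j] is compared with the tangent to
    the power function at [c]. *)
Lemma powR_jensen (I : finType) (p s : R) (w a : I -> R) :
  1 <= p -> 0 < s -> (forall j, 0 <= w j) -> (forall j, 0 <= a j) ->
  \sum_j w j <= s ->
  s * ((\sum_j w j * a j) / s) `^ p <= \sum_j w j * a j `^ p.
Proof.
move=> p1 s0 w0 a0 ws; have p0 : 0 < p by exact: lt_le_trans p1.
set c := (\sum_j w j * a j) / s.
have sc : \sum_j w j * a j = s * c by rewrite /c mulrCA mulfV ?mulr1 ?gt_eqF.
have : 0 <= c by rewrite divr_ge0 ?(ltW s0) // sumr_ge0 // => j _; rewrite mulr_ge0.
rewrite le_eqVlt => /predU1P[<-|c0].
  by rewrite powR0 ?gt_eqF // mulr0 sumr_ge0 // => j _; rewrite mulr_ge0 ?powR_ge0.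
clearbody c.
have tangent j : c `^ p * (1 + p * (a j / c - 1)) <= a j `^ p.
  have {2}-> : a j = c * (a j / c) by rewrite mulrCA mulfV ?mulr1 ?gt_eqF.
  rewrite powRM ?(ltW c0) ?divr_ge0 ?(ltW c0) // ler_wpM2l ?powR_ge0 //.
  by apply: powR_bernoulli; rewrite ?divr_ge0 ?(ltW c0).
apply: le_trans (_ : \sum_j w j * (c `^ p * (1 + p * (a j / c - 1))) <= _); last first.
  by apply: ler_sum => j _; rewrite ler_wpM2l.
(* The weighted tangents add up to this; the missing mass [s - \sum_j w j] enters with the
   non-negative factor [p - 1]. *)
rewrite [leRHS](_ : _ = c `^ p * (s + (p - 1) * (s - \sum_j w j))).
  rewrite [s * _]mulrC ler_wpM2l ?powR_ge0 // lerDl mulr_ge0 ?subr_ge0 //.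
have {1}-> : s = (\sum_j w j * a j) / c by rewrite sc mulfK ?gt_eqF.
have -> : s - \sum_j w j = (\sum_j w j * a j) / c - \sum_j w j.
  by rewrite sc mulfK ?gt_eqF.
rewrite -sumrN mulr_suml -big_split /= !mulr_sumr -big_split /= mulr_sumr.
by apply: eq_bigr => j _; ring.
Qed.

(** For [p = +oo] the row sums suffice. For finite [p], Jensen in each row uses the row sums, and
    the column sums enter after exchanging the two summations. *)
Lemma schur_lpnorm n (K : 'I_n -> 'I_n -> R) (s : R) (x y : 'cV[R]_n) (p : \bar R) :
  0 <= s -> (forall i j, 0 <= K i j) ->
  (forall i, \sum_j K i j <= s) -> (forall j, \sum_i K i j <= s) ->
  (forall i, `|y i 0| <= \sum_j K i j * `|x j 0|) ->
  (1 <= p)%E -> lpnorm p y <= s * lpnorm p x.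
Proof.
move=> s0 K0 rows cols yK; case: p => [p|_|//] /=; last first.
  apply: bigmax_le => [|i _]; first by rewrite mulr_ge0 // bigmax_ge_id.
  apply: le_trans (yK i) _.
  apply: le_trans (_ : (\sum_j K i j) * \big[Num.max/0]_k `|x k 0| <= _).
    by rewrite mulr_suml; apply: ler_sum => j _; rewrite ler_wpM2l // le_bigmax.
  by rewrite ler_wpM2r // bigmax_ge_id.
rewrite lee_fin => p1; have p0 : 0 < p by exact: lt_le_trans p1.
have sum0 (v : 'cV[R]_n) : 0 <= \sum_i `|v i 0| `^ p.
  by rewrite sumr_ge0 // => i _; rewrite powR_ge0.
suff key : \sum_i `|y i 0| `^ p <= s `^ p * \sum_i `|x i 0| `^ p.
  apply: le_trans (_ : (s `^ p * \sum_i `|x i 0| `^ p) `^ p^-1 <= _).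
    by rewrite ge0_ler_powR ?nnegrE ?invr_ge0 ?(ltW p0) // mulr_ge0 ?powR_ge0.
  by rewrite powRM ?powR_ge0 // -powRrM mulfV ?gt_eqF // powRr1.
(* Jensen divides by [s]; when [s = 0] the kernel vanishes. *)
move: s0; rewrite le_eqVlt => /predU1P[s0|s0].
  have y0 i : `|y i 0| = 0.
    apply/le_anti; rewrite normr_ge0 andbT (le_trans (yK i)) // big1 // => j _.
    suff -> : K i j = 0 by rewrite mul0r.
    apply/le_anti; rewrite K0 andbT s0; apply: le_trans (rows i).
    by rewrite (bigD1 j) //= lerDl sumr_ge0.
  rewrite big1 ?mulr_ge0 ?powR_ge0 // => i _; by rewrite y0 powR0 // gt_eqF.
have step i : `|y i 0| `^ p <= s `^ p / s * \sum_j K i j * `|x j 0| `^ p.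
  apply: le_trans (_ : (\sum_j K i j * `|x j 0|) `^ p <= _).
    rewrite ge0_ler_powR ?nnegrE ?(ltW p0) // sumr_ge0 // => j _.
    by rewrite mulr_ge0.
  have h := powR_jensen p1 s0 (K0 i) (fun j => normr_ge0 (x j 0)) (rows i).
  set S := \sum_j K i j * `|x j 0| in h *.
  have S0 : 0 <= S by rewrite sumr_ge0 // => j _; rewrite mulr_ge0.
  apply: le_trans (ler_wpM2l _ h); last by rewrite divr_ge0 ?powR_ge0 // ltW.
  by rewrite mulrA divfK ?gt_eqF // -powRM ?divr_ge0 ?(ltW s0) // mulrCA mulfV ?mulr1 ?gt_eqF.
apply: le_trans (ler_sum _ (fun i _ => step i)) _.
rewrite -mulr_sumr exchange_big /=.
apply: le_trans (_ : s `^ p / s * \sum_j s * `|x j 0| `^ p <= _).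
  rewrite ler_wpM2l ?divr_ge0 ?powR_ge0 ?(ltW s0) //; apply: ler_sum => j _.
  by rewrite -mulr_suml ler_wpM2r ?powR_ge0.
by rewrite -mulr_sumr mulrA divfK ?gt_eqF.
Qed.

End SchurTest.

(** * Decay of solutions of banded systems *)

(** The step is [2 / (L + L / k)], which centres the spectral interval [[L / k, L]] at 1: its end
    points go to [1 - s] and [1 + s] with [s = (k - 1) / (k + 1)]. *)
Lemma richardson_contraction (R : realType) n (M : 'M[R]_n) (L k : R) :
  1 < k -> 0 < L -> M^T = M ->
  (forall u, L / k * dot u u <= dot u (M *m u)) ->
  (forall u, dot u (M *m u) <= L * dot u u) ->
  forall u, enorm (u - (2 * k / (L * (k + 1))) *: (M *m u)) <=
    (k - 1) / (k + 1) * enorm u.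
Proof.
move=> k1 L0 Msym Mge Mle v.
set s := (k - 1) / (k + 1); set tau := 2 * k / (L * (k + 1)).
have k0 : 0 < k by lra.
have kp : 0 < k + 1 by lra.
have tau0 : 0 < tau by rewrite divr_gt0 ?mulr_gt0.
have s0 : 0 <= s by rewrite divr_ge0 ?(ltW kp) // subr_ge0 ltW.
have QE u : (1%:M - tau *: M) *m u = u - tau *: (M *m u).
  by rewrite mulmxBl mul1mx scalemxAl.
rewrite -QE; apply: sym_enorm_le => // [|u].
  by rewrite linearB /= linearZ /= Msym trmx1.
rewrite QE dotBr dotZr ler_norml.
have h1 := ler_wpM2l (ltW tau0) (Mge u); have h2 := ler_wpM2l (ltW tau0) (Mle u).
have t1 : tau * (L / k * dot u u) = (1 - s) * dot u u.
  by rewrite /tau /s; field; rewrite !gt_eqF.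
have t2 : tau * (L * dot u u) = (1 + s) * dot u u.
  by rewrite /tau /s; field; rewrite !gt_eqF.
by rewrite t1 in h1; rewrite t2 in h2; apply/andP; split; lra.
Qed.

Section Decay.
Context {R : realType} (V : finType) (e : rel V).
Hypothesis e_conn : connected_graph e.
Context (n : nat) (lab : 'I_n -> V).

(** Indices carry labels, not necessarily distinct, because in a KKT system a vertex can hold both
    an unknown and a multiplier. *)
Definition banded (w : nat) (B : 'M[R]_n) : Prop :=
  forall i k, (w < gdist e (lab i) (lab k))%N -> B i k = 0.

Definition supp_within (j : V) (w : nat) (v : 'cV[R]_n) : Prop :=
  forall i, (w < gdist e (lab i) j)%N -> v i 0 = 0.

Lemma supp_withinW j w w' v : (w <= w')%N -> supp_within j w v -> supp_within j w' v.
Proof. by move=> ww vw i hi; apply: vw; apply: leq_ltn_trans hi. Qed.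

Lemma supp_withinD j w u v :
  supp_within j w u -> supp_within j w v -> supp_within j w (u + v).
Proof. by move=> uw vw i hi; rewrite mxE uw // vw // addr0. Qed.

Lemma supp_withinZ j w a v : supp_within j w v -> supp_within j w (a *: v).
Proof. by move=> vw i hi; rewrite mxE vw // mulr0. Qed.

Lemma supp_withinB j w u v :
  supp_within j w u -> supp_within j w v -> supp_within j w (u - v).
Proof. by move=> uw vw i hi; rewrite !mxE uw // vw // subr0. Qed.

Lemma supp_within_mul j k w B v :
  banded w B -> supp_within j k v -> supp_within j (k + w) (B *m v).
Proof.
move=> Bw vk i hi; rewrite mxE big1 // => l _.
have [hl|hl] := ltnP k (gdist e (lab l) j); first by rewrite vk // mulr0.
rewrite Bw ?mul0r // ltnNge; apply/negP => hw; move: hi.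
rewrite ltnNge (leq_trans (gdist_triangle e_conn _ (lab l) _)) //.
by rewrite addnC leq_add.
Qed.

(* Iterating z := Q z + (g - Q g) from 0 keeps z local, and g - z = Q^N g. *)
Lemma decay_contraction (Q : 'M[R]_n) (L : nat) (theta : R) g j N i :
  0 <= theta ->
  (forall k v, supp_within j k v -> supp_within j (k + L) (Q *m v)) ->
  (forall v, enorm (Q *m v) <= theta * enorm v) ->
  supp_within j L (g - Q *m g) -> (L * N < gdist e (lab i) j)%N ->
  `|g i 0| <= theta ^+ N * enorm g.
Proof.
move=> th0 Qloc Qth gloc hN.
have [z [zloc gz]] : exists z, supp_within j (L * N) z /\
    enorm (g - z) <= theta ^+ N * enorm g.
  elim: N {hN} => [|N [z [zloc gz]]].
    by exists 0; split; [move=> k _; rewrite mxE | rewrite subr0 mul1r].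
  exists (Q *m z + (g - Q *m g)); split.
    apply: supp_withinD; last by apply: supp_withinW gloc; rewrite mulnS leq_addr.
    by rewrite mulnS addnC; exact: Qloc.
  have -> : g - (Q *m z + (g - Q *m g)) = Q *m (g - z).
    rewrite mulmxBr; move: (Q *m z) (Q *m g) => a b.
    by apply/matrixP => ? ?; rewrite !mxE; ring.
  by apply: le_trans (Qth _) _; rewrite exprS -mulrA ler_wpM2l.
have -> : g i 0 = (g - z) i 0 by rewrite mxE [in RHS]mxE zloc // subr0.
exact: le_trans (entry_le_enorm _ _) gz.
Qed.

(** Richardson iteration from 0. The norm hypothesis bounds the first iterate by
    [s = (k - 1) / (k + 1)], so [enorm g <= s * enorm g + s]; solving this yields the factor
    [s * ((k + 1) / 2)] and with it the extra power of [s]. *)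
Lemma decay_posdef (M : 'M[R]_n) (m : nat) (L k : R) g j N i :
  1 < k -> 0 < L -> M^T = M -> banded (2 * m) M ->
  (forall u, L / k * dot u u <= dot u (M *m u)) ->
  (forall u, dot u (M *m u) <= L * dot u u) ->
  supp_within j (2 * m) (M *m g) ->
  2 * k / (L * (k + 1)) * enorm (M *m g) <= (k - 1) / (k + 1) ->
  (2 * m * N < gdist e (lab i) j)%N ->
  `|g i 0| <= ((k - 1) / (k + 1)) ^+ N.+1 * ((k + 1) / 2).
Proof.
move=> k1 L0 Msym Mband Mge Mle gsupp gnorm hN.
set s := (k - 1) / (k + 1) in gnorm *; set tau := 2 * k / (L * (k + 1)) in gnorm.
have k0 : 0 < k by lra.
have kp : 0 < k + 1 by lra.
have tau0 : 0 < tau by rewrite divr_gt0 ?mulr_gt0.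
have s0 : 0 <= s by rewrite divr_ge0 ?(ltW kp) // subr_ge0 ltW.
pose Q := 1%:M - tau *: M.
have QE v : Q *m v = v - tau *: (M *m v) by rewrite mulmxBl mul1mx scalemxAl.
have Qs v : enorm (Q *m v) <= s * enorm v.
  by rewrite QE; exact: richardson_contraction.
have gQ : g - Q *m g = tau *: (M *m g) by rewrite QE opprB addrC subrK.
have gE : enorm g <= s * ((k + 1) / 2).
  have h : enorm g <= s * enorm g + s.
    apply: le_trans (_ : enorm (Q *m g + (g - Q *m g)) <= _); first by rewrite subrKC.
    apply: le_trans (enormD _ _) _; rewrite lerD // gQ enormZ gtr0_norm //.
  have : enorm g * (1 - s) <= s by lra.
  have -> : 1 - s = 2 / (k + 1) by rewrite /s; field; rewrite gt_eqF.
  by rewrite -ler_pdivlMr ?divr_gt0 // invf_div.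
rewrite exprSr -mulrA.
apply: le_trans (decay_contraction s0 _ Qs _ hN) _.
- move=> w v vw; rewrite QE; apply: supp_withinB.
    by apply: supp_withinW vw; rewrite leq_addr.
  by apply: supp_withinZ; apply: supp_within_mul.
- by rewrite gQ; apply: supp_withinZ.
by rewrite ler_wpM2l // exprn_ge0.
Qed.

(* The polynomial Q = T_2(S) / T_2(x) in M^2, with S the affine image of M^2
   having spectrum in [-1, 1] and T_2 = 2 X^2 - 1 the Chebyshev polynomial,
   contracts three times faster (in exponent) than S / x for twice the degree,
   since T_2(x) >= x^3; the gain absorbs the multiplicative constants. *)
Lemma decay_indefinite (M : 'M[R]_n) (m : nat) (B k : R) g j N i :
  6 <= k -> 0 < B -> M^T = M -> banded (2 * m) M ->
  (forall u, enorm (M *m u) <= B * enorm u) ->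
  (forall u, B * enorm u <= k * enorm (M *m u)) ->
  supp_within j (2 * m) (M *m g) -> enorm (M *m g) <= B ->
  (8 * m * N < gdist e (lab i) j)%N ->
  `|g i 0| <= ((k ^+ 2 - 1) / (k ^+ 2 + 1)) ^+ (3 * N) * k.
Proof.
move=> k6 B0 Msym Mband Mle Mge gsupp gnorm hN.
have kk : 36 <= k ^+ 2 by nra.
have k1 : 0 < k ^+ 2 - 1 by lra.
have k0 : 0 < k by lra.
pose x := (k ^+ 2 + 1) / (k ^+ 2 - 1).
have x0 : 0 < x by rewrite divr_gt0 //; lra.
have x1 : 1 <= x by rewrite ler_pdivlMr //; lra.
have x2 : x <= 3 / 2 by rewrite ler_pdivrMr //; lra.
have T0 : 0 < 2 * x ^+ 2 - 1 by nra.
have Tx : x ^+ 3 <= 2 * x ^+ 2 - 1.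
  (* This product is [2 x^2 - 1 - x^3]; its second factor is non-negative because [x <= 3 / 2]. *)
  have : 0 <= (x - 1) * (1 + x - x ^+ 2) by rewrite mulr_ge0 ?subr_ge0 //; nra.
  rewrite !exprS expr0; lra.
(* The map [y -> sig y - x] sends the interval [[B^2 / k^2, B^2]] containing the spectrum of [M^2]
   onto [[-1, 1]]. *)
pose sig := 2 * k ^+ 2 / (B ^+ 2 * (k ^+ 2 - 1)).
have sig0 : 0 < sig by rewrite divr_gt0 ?mulr_gt0 ?exprn_gt0.
pose S := sig *: (M *m M) - x%:M.
have SE v : S *m v = sig *: (M *m (M *m v)) - x *: v.
  by rewrite mulmxBl -scalemxAl mulmxA mul_scalar_mx.
have Ssym : S^T = S by rewrite /S linearB /= linearZ /= trmx_mul Msym tr_scalar_mx.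
have S1 v : enorm (S *m v) <= 1 * enorm v.
  apply: sym_enorm_le => // u; rewrite SE dotBr !dotZr.
  have -> : dot u (M *m (M *m u)) = dot (M *m u) (M *m u) by rewrite dot_mul Msym.
  have h1 := dot_le_of_enorm_le (ltW B0) (Mle u).
  have h2 : B ^+ 2 * dot u u <= k ^+ 2 * dot (M *m u) (M *m u).
    rewrite -!sqr_enorm -!exprMn ler_pXn2r ?nnegrE ?mulr_ge0 ?enorm_ge0 ?(ltW k0) ?(ltW B0) //.
  have t1 : sig * dot (M *m u) (M *m u) <= (1 + x) * dot u u.
    have -> : 1 + x = sig * B ^+ 2 by rewrite /sig /x; field; rewrite !gt_eqF.
    by rewrite -mulrA ler_pM2l.
  have t2 : (x - 1) * dot u u <= sig * dot (M *m u) (M *m u).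
    have -> : x - 1 = sig * (B ^+ 2 / k ^+ 2) by rewrite /sig /x; field; rewrite !gt_eqF.
    rewrite -mulrA ler_pM2l // mulrAC ler_pdivrMr ?exprn_gt0 // [leRHS]mulrC //.
  by rewrite ler_norml; apply/andP; split; lra.
clearbody S.
pose Q := (2 * x ^+ 2 - 1)^-1 *: (2 *: (S *m S) - 1%:M).
have QE v : Q *m v = (2 * x ^+ 2 - 1)^-1 *: (2 *: (S *m (S *m v)) - v).
  by rewrite /Q -scalemxAl mulmxBl -scalemxAl mulmxA mul1mx.
have Qth v : enorm (Q *m v) <= (2 * x ^+ 2 - 1)^-1 * enorm v.
  rewrite QE enormZ gtr0_norm ?invr_gt0 // ler_pM2l ?invr_gt0 //.
  have -> : 2 *: (S *m (S *m v)) - v = (2 *: (S *m S) - 1%:M) *m v.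
    by rewrite mulmxBl -scalemxAl mulmxA mul1mx.
  rewrite -[leRHS]mul1r; apply: sym_enorm_le => // [|u].
    by rewrite linearB /= linearZ /= trmx_mul Ssym trmx1.
  rewrite mulmxBl -scalemxAl mul1mx -mulmxA dotBr dotZr.
  have -> : dot u (S *m (S *m u)) = dot (S *m u) (S *m u) by rewrite dot_mul Ssym.
  have := dot_le_of_enorm_le ler01 (S1 u); have := dot_ge0 (S *m u); have := dot_ge0 u.
  by rewrite expr1n ler_norml => *; apply/andP; split; lra.
have Mloc w v : supp_within j w v -> supp_within j (w + 2 * m) (M *m v).
  exact: supp_within_mul.
have Sloc w v : supp_within j w v -> supp_within j (w + 4 * m) (S *m v).
  move=> vw; rewrite SE; apply: supp_withinB; apply: supp_withinZ.
    by have := Mloc _ _ (Mloc _ _ vw); apply: supp_withinW; clear; lia.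
  by apply: supp_withinW vw; clear; lia.
(* [1 - T_2(S) / T_2(x)] is a multiple of [(x - S) (x + S)], and [x + S = sig M^2]. So [g - Q g] is
   a polynomial in [M] applied to the local vector [M g]. *)
have gQ : g - Q *m g = ((2 * x ^+ 2 - 1)^-1 * 2 * sig) *:
    (x *: (M *m (M *m g)) - S *m (M *m (M *m g))).
  have SSg : S *m (S *m g) = sig *: (S *m (M *m (M *m g))) - x *: (S *m g).
    by rewrite {1}(SE _ g) mulmxBr -!scalemxAr.
  rewrite QE SSg (SE _ g).
  move: (M *m (M *m g)) (S *m _) => h sh.
  apply/matrixP => a b; rewrite !mxE; field.
  by rewrite gt_eqF.
have gn : enorm g <= k.
  have := Mge g; move: (ler_wpM2l (ltW k0) gnorm) => h1 h2.
  have := le_trans h2 h1; rewrite mulrC ler_pM2r //.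
apply: le_trans (decay_contraction _ _ Qth _ hN) _.
- by rewrite invr_ge0 ltW.
- move=> w v vw; rewrite QE; apply: supp_withinZ; apply: supp_withinB.
    by apply: supp_withinZ; have := Sloc _ _ (Sloc _ _ vw); apply: supp_withinW; clear; lia.
  by apply: supp_withinW vw; clear; lia.
- rewrite gQ; apply: supp_withinZ; apply: supp_withinB.
    by apply: supp_withinZ; have := Mloc _ _ gsupp; apply: supp_withinW; clear; lia.
  by have := Sloc _ _ (Mloc _ _ gsupp); apply: supp_withinW; clear; lia.
apply: ler_pM => //; rewrite ?exprn_ge0 ?invr_ge0 ?enorm_ge0 ?(ltW T0) //.
rewrite exprM lerXn2r ?nnegrE ?exprn_ge0 ?invr_ge0 ?(ltW T0) //.
  by rewrite divr_ge0 //; lra.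
rewrite -invf_div exprVn lef_pV2 ?posrE ?exprn_gt0 //.
Qed.

End Decay.

(** * Absorption of the constants *)

Section Absorption.
Context {R : realType} (k t : R) (m k0 : nat).
Hypotheses (k_gt1 : 1 < k) (t_gt0 : 0 < t) (m_gt0 : (0 < m)%N) (k0_gt1 : (1 < k0)%N).
Hypothesis rateE : (k ^+ 2 - 1) / (k ^+ 2 + 1) = expR (- (4 * m%:R * t)).
Hypothesis k0_le : k0.+1%:R <= expR (t * k0.+1%:R).

Let m1 : 1 <= m%:R :> R. Proof. by rewrite ler1n. Qed.
Let k2_gt1 : 0 < k ^+ 2 - 1.
Proof.
have : 0 < (k - 1) * (k + 1) by rewrite mulr_gt0 //; move: k_gt1; lra.
by rewrite expr2; lra.
Qed.

Let rateVE : expR (4 * m%:R * t) = (k ^+ 2 + 1) / (k ^+ 2 - 1).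
Proof. by rewrite -[LHS]invrK -expRN -rateE invf_div. Qed.

(** Two bounds are combined: [k0_le] forces [t (k0 + 1) >= 4 / 5], and [1 + 4 m t <= exp (4 m t) = 1
    + 2 / (k^2 - 1)] gives [t <= 1 / (2 (k^2 - 1))]. *)
Let radius_large : 8 / 5 * (k ^+ 2 - 1) <= k0.+1%:R.
Proof.
have [k1 t0 mm k21] := And4 k_gt1 t_gt0 m1 k2_gt1.
have u45 : 4 / 5 <= t * k0.+1%:R.
  (* If [u < 4 / 5], then [exp (- u / 2) > 3 / 5], while [exp u >= k0 + 1 >= 3]; but
     [3 (3 / 5)^2 > 1]. *)
  rewrite leNgt; apply/negP; set u := t * _ => u45.
  have k03 : (3 : R) <= k0.+1%:R by rewrite ler_nat.
  have e3 : 3 <= expR u by exact: le_trans k0_le.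
  have h : 1 - u / 2 <= expR (- (u / 2)) by exact: expR_ge1Dx.
  have eE : expR u * expR (- (u / 2)) ^+ 2 = 1.
    by rewrite -expRM_natl -expRD -[RHS]expR0; congr expR; field.
  have : 3 * (3 / 5) ^+ 2 <= 1 :> R.
    rewrite -[leRHS]eE ler_pM // ?exprn_ge0 // ?ler_pXn2r ?nnegrE ?expR_ge0 //; lra.
  by rewrite expr2; lra.
have tk : 2 * t * (k ^+ 2 - 1) <= 1.
  have : 1 + 4 * m%:R * t <= expR (4 * m%:R * t) by exact: expR_ge1Dx.
  rewrite rateVE ler_pdivlMr // => h.
  have : 0 <= (m%:R - 1) * (t * (k ^+ 2 - 1)).
    by rewrite !mulr_ge0 ?(ltW t_gt0) ?(ltW k2_gt1) // subr_ge0.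
  lra.
have k00 : 0 <= k0.+1%:R :> R by [].
have := ler_wpM2r k00 tk; have := ler_wpM2r (ltW k2_gt1) u45; lra.
Qed.

Let ler_expRt (a b : R) : a <= b -> expR (t * a) <= expR (t * b).
Proof. by move=> ab; rewrite ler_expR ler_pM2l. Qed.

(** The power of [s] decays like [exp (- 2 t rho)] or better; the surplus over [exp (- t rho)]
    absorbs [(k + 1) / 2] through [k0_le]. *)
Lemma absorb_posdef (N rho : nat) : (k0 <= rho)%N -> (rho <= 2 * m * N.+1)%N ->
  ((k - 1) / (k + 1)) ^+ N.+1 * ((k + 1) / 2) <= expR (- t * rho.+1%:R).
Proof.
have [k1 t0 mm k21] := And4 k_gt1 t_gt0 m1 k2_gt1.
move=> k0rho rhoN; set s := (k - 1) / (k + 1).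
have s0 : 0 <= s by rewrite divr_ge0 //; lra.
have kr : k0%:R <= rho%:R :> R by rewrite ler_nat.
have k02 : 2 <= k0%:R :> R by rewrite ler_nat.
have rN : rho%:R <= 2 * m%:R * N.+1%:R :> R by rewrite -!natrM ler_nat.
have q2 j : ((k ^+ 2 - 1) / (k ^+ 2 + 1)) ^+ (j * N.+1) <= expR (t * (- (2 * j%:R) * rho%:R)).
  rewrite rateE -expRM_natl ler_expR natrM.
  have := ler_wpM2l (mulr_ge0 (ler0n R j) (ltW t_gt0)) rN; lra.
(* For [k] near 1 the bound [s <= q] is enough, the constant being below [5 / 4]. For larger [k] the
   stronger [s^2 <= q^3] holds and gives decay [exp (- 3 t rho)]. *)
have [k32|k32] := ltrP k (3 / 2).
  have sq : s <= (k ^+ 2 - 1) / (k ^+ 2 + 1).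
    rewrite /s ler_pdivlMr; last by nra.
    rewrite mulrAC ler_pdivrMr; last by lra.
    have : 0 <= (k - 1) * k by rewrite mulr_ge0 //; lra.
    by rewrite !expr2; nra.
  have h1 : s ^+ N.+1 <= expR (t * (- 2 * rho%:R)).
    apply: le_trans (_ : ((k ^+ 2 - 1) / (k ^+ 2 + 1)) ^+ (1 * N.+1) <= _).
      by rewrite mul1n lerXn2r ?nnegrE // (le_trans s0).
    by apply: le_trans (q2 1%N) _; rewrite mulr1.
  have h2 : (k + 1) / 2 <= expR (t * (rho%:R - 1)).
    rewrite -(@ler_pXn2r _ 3) ?nnegrE ?expR_ge0 //; last by lra.
    apply: le_trans (_ : 3 <= _).
      apply: le_trans (_ : (5 / 4) ^+ 3 <= _).
        by rewrite lerXn2r ?nnegrE //; lra.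
      by rewrite !exprS expr0; lra.
    apply: le_trans (_ : k0.+1%:R <= _); first by rewrite ler_nat.
    apply: le_trans k0_le _; rewrite -expRM_natl mulrCA; apply: ler_expRt.
    rewrite -natr1; lra.
  apply: le_trans (ler_pM _ _ h1 h2) _; rewrite ?exprn_ge0 //; first by lra.
  by rewrite -expRD ler_expR -natr1; lra.
have sq : s ^+ 2 <= ((k ^+ 2 - 1) / (k ^+ 2 + 1)) ^+ 3.
  have kp : 0 < k + 1 by lra.
  have kq : 0 < k ^+ 2 + 1 by lra.
  rewrite /s !expr_div_n ler_pdivlMr ?exprn_gt0 // mulrAC ler_pdivrMr ?exprn_gt0 //.
  have -> : (k ^+ 2 - 1) ^+ 3 * (k + 1) ^+ 2 = (k - 1) ^+ 2 * ((k + 1) ^+ 5 * (k - 1)).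
    by ring.
  rewrite ler_wpM2l ?sqr_ge0 //.
  (* Recentred at [3 / 2], the difference has only positive coefficients. *)
  pose h := k - 3 / 2; have h0 : 0 <= h by rewrite subr_ge0.
  have -> : k = h + 3 / 2 by rewrite /h subrK.
  rewrite -subr_ge0.
  have -> : ((h + 3 / 2 + 1) ^+ 5 * (h + 3 / 2 - 1) - ((h + 3 / 2) ^+ 2 + 1) ^+ 3) =
    4 * h ^+ 5 + 32 * h ^+ 4 + 102 * h ^+ 3 + 154 * h ^+ 2 + 401 / 4 * h + 29 / 2.
    by field.
  have := And5 (exprn_ge0 5 h0) (exprn_ge0 4 h0) (exprn_ge0 3 h0) (exprn_ge0 2 h0) h0.
  by case; lra.
have h1 : s ^+ N.+1 <= expR (t * (- 3 * rho%:R)).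
  rewrite -(@ler_pXn2r _ 2) ?nnegrE ?expR_ge0 ?exprn_ge0 //.
  rewrite exprAC; apply: le_trans (_ : (((k ^+ 2 - 1) / (k ^+ 2 + 1)) ^+ 3) ^+ N.+1 <= _).
    by rewrite lerXn2r ?nnegrE ?exprn_ge0 // divr_ge0 //; lra.
  rewrite -exprM; apply: le_trans (q2 3%N) _.
  by rewrite -expRM_natl ler_expR; lra.
have h2 : (k + 1) / 2 <= expR (t * (2 * rho%:R - 1)).
  apply: le_trans (_ : k0.+1%:R <= _); first by apply: le_trans radius_large; nra.
  by apply: le_trans k0_le _; apply: ler_expRt; rewrite -natr1; lra.
apply: le_trans (ler_pM _ _ h1 h2) _; rewrite ?exprn_ge0 //; first by lra.
by rewrite -expRD ler_expR -natr1; lra.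
Qed.

(** The power decays like [exp (- 3 / 2 t rho)], up to a factor [x^3] with [x = exp (4 m t)] for
    having [N] in place of [N + 1]. The surplus [exp (t rho / 2)] absorbs [k x^3], since [k0 + 1] is
    of order [k^2]. *)
Lemma absorb_indefinite (N rho : nat) : 6 <= k ->
  (k0 <= rho)%N -> (rho <= 8 * m * N.+1)%N ->
  ((k ^+ 2 - 1) / (k ^+ 2 + 1)) ^+ (3 * N) * k <= expR (- t * rho.+1%:R).
Proof.
have [k1 t0 mm k21] := And4 k_gt1 t_gt0 m1 k2_gt1.
move=> k6 k0rho rhoN.
have kr : k0%:R <= rho%:R :> R by rewrite ler_nat.
have rN : rho%:R <= 8 * m%:R * N.+1%:R :> R by rewrite -!natrM ler_nat.
have kk : 36 <= k ^+ 2 by nra.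
pose x := expR (4 * m%:R * t).
have x0 : 0 < x by exact: expR_gt0.
have xle : x <= 37 / 35 by rewrite /x rateVE ler_pdivrMr //; lra.
have h1 : ((k ^+ 2 - 1) / (k ^+ 2 + 1)) ^+ (3 * N) <= expR (t * (- (3 / 2) * rho%:R)) * x ^+ 3.
  rewrite rateE /x -!expRM_natl -expRD ler_expR natrM.
  have := ler_wpM2l (ltW t_gt0) rN; rewrite -natr1; lra.
have h2 : k * x ^+ 3 <= expR (t * (rho%:R / 2 - 1)).
  rewrite -(@ler_pXn2r _ 2) ?nnegrE ?expR_ge0 ?mulr_ge0 ?exprn_ge0 ?(ltW x0) //; last by lra.
  (* Multiplying by [expR (3 * t)] raises the squared target from [exp (t (rho - 2))] to
     [exp (t (rho + 1))], where [k0_le] applies. *)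
  have e3 : expR (3 * t) <= x by rewrite ler_expR ler_pM2r //; lra.
  rewrite -(@ler_pM2r _ (expR (3 * t))) ?expR_gt0 //.
  apply: le_trans (_ : (k * x ^+ 3) ^+ 2 * x <= _).
    by rewrite ler_wpM2l // exprn_ge0 // mulr_ge0 ?exprn_ge0 ?(ltW x0) //; lra.
  have -> : expR (t * (rho%:R / 2 - 1)) ^+ 2 * expR (3 * t) = expR (t * rho.+1%:R).
    by rewrite -expRM_natl -expRD -natr1; congr expR; field.
  apply: le_trans (_ : k0.+1%:R <= _); last first.
    by apply: le_trans k0_le _; apply: ler_expRt; rewrite ler_nat.
  apply: le_trans radius_large.
  have -> : (k * x ^+ 3) ^+ 2 * x = k ^+ 2 * x ^+ 7 by ring.
  apply: le_trans (_ : k ^+ 2 * (37 / 35) ^+ 7 <= _).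
    by rewrite ler_wpM2l ?sqr_ge0 // lerXn2r ?nnegrE ?(ltW x0).
  by rewrite !exprS expr0; lra.
apply: le_trans (ler_wpM2r _ h1) _; first by lra.
rewrite -mulrA [_ ^+ 3 * k]mulrC; apply: le_trans (ler_wpM2l (expR_ge0 _) h2) _.
by rewrite -expRD ler_expR -natr1; lra.
Qed.

End Absorption.

(** * Operator norm and first-order optimality *)

Section OperatorNorm.
Context {R : realType}.

Lemma lpnorm2E n (u : 'cV[R]_n) : lpnorm 2%:E u = enorm u.
Proof.
rewrite /lpnorm /enorm dotE powR12_sqrt ?sumr_ge0 //.
congr Num.sqrt; apply: eq_bigr => i _.
by rewrite powR_mulrn // real_normK ?num_real // expr2.
Qed.

(** The Frobenius bound; it shows that the supremum defining [opnorm] is over a bounded set. *)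
Lemma mulmx_enorm_bounded p q (A : 'M[R]_(p, q)) :
  exists2 C, 0 <= C & forall u, enorm (A *m u) <= C * enorm u.
Proof.
pose r i := enorm (row i A)^T.
exists (Num.sqrt (\sum_i r i ^+ 2)) => [|u]; first exact: sqrtr_ge0.
apply: enorm_le; first exact: sqrtr_ge0.
rewrite sqr_sqrtr; last by rewrite sumr_ge0 // => i _; exact: sqr_ge0.
rewrite dotE mulr_suml; apply: ler_sum => i _.
have -> : (A *m u) i 0 = dot (row i A)^T u.
  by rewrite /dot trmxK -row_mul [RHS]mxE.
rewrite -sqr_enorm -exprMn -expr2 -(real_normK (num_real (dot _ _))).
by rewrite lerXn2r ?nnegrE ?mulr_ge0 ?enorm_ge0 // dot_CS.
Qed.

Lemma opnorm_ge0 p q (A : 'M[R]_(p, q)) : 0 <= opnorm A.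
Proof.
rewrite /opnorm; apply: ub_le_sup.
  have [C C0 hC] := mulmx_enorm_bounded A; exists C => _ [u u1 <-].
  rewrite lpnorm2E; apply: le_trans (hC u) _; rewrite -[leRHS]mulr1 ler_wpM2l //.
  by rewrite -lpnorm2E.
exists 0; first by rewrite /mkset lpnorm2E enorm0.
by rewrite mulmx0 lpnorm2E enorm0.
Qed.

Lemma opnorm_le p q (A : 'M[R]_(p, q)) u : enorm (A *m u) <= opnorm A * enorm u.
Proof.
have [/eqP u0|u0] := boolP (enorm u == 0).
  by rewrite (enorm_eq0 u0) mulmx0 !enorm0 mulr0.
have u1 : 0 < enorm u by rewrite lt_neqAle eq_sym u0 enorm_ge0.
rewrite -ler_pdivrMr // mulrC -[X in X * _]ger0_norm ?invr_ge0 ?enorm_ge0 //.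
rewrite -enormZ scalemxAr /opnorm; apply: ub_le_sup.
  have [C C0 hC] := mulmx_enorm_bounded A; exists C => _ [v v1 <-].
  rewrite lpnorm2E; apply: le_trans (hC v) _; rewrite -[leRHS]mulr1 ler_wpM2l //.
  by rewrite -lpnorm2E.
exists ((enorm u)^-1 *: u); last by rewrite lpnorm2E.
by rewrite /mkset lpnorm2E enormZ ger0_norm ?invr_ge0 ?enorm_ge0 // mulVf.
Qed.

Lemma opnorm_trmx_le p q (A : 'M[R]_(p, q)) v : enorm (A^T *m v) <= opnorm A * enorm v.
Proof.
have [/eqP u0|u0] := boolP (enorm (A^T *m v) == 0).
  by rewrite u0 mulr_ge0 ?opnorm_ge0 ?enorm_ge0.
have u1 : 0 < enorm (A^T *m v) by rewrite lt_neqAle eq_sym u0 enorm_ge0.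
rewrite -(ler_pM2l u1) -expr2 sqr_enorm dot_mul trmxK.
apply: le_trans (ler_norm _) _; apply: le_trans (dot_CS _ _) _.
rewrite mulrC mulrA ler_wpM2r ?enorm_ge0 //.
by rewrite [leRHS]mulrC opnorm_le.
Qed.

(** Existence of Lagrange multipliers: the columns of the cokernel matrix span the kernel of [A],
    and a row killed by them lies in the row space. *)
Lemma orthogonal_kernel p q (A : 'M[R]_(p, q)) (g : 'cV[R]_q) :
  (forall v, A *m v = 0 -> dot g v = 0) -> exists mu, g = A^T *m mu.
Proof.
move=> gA; have /submxP[D gD] : (g^T <= A)%MS.
  rewrite submxE; move: (cokermx A) (mulmx_coker A) => C AC.
  apply/eqP/rowP => j; rewrite [RHS]mxE.
  have -> : (g^T *m C) 0 j = dot g (col j C).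
    by rewrite /dot colE mulmxA -colE [RHS]mxE.
  by apply: gA; rewrite colE mulmxA AC mul0mx.
by exists D^T; rewrite -trmx_mul -gD trmxK.
Qed.

End OperatorNorm.

Section FirstOrder.
Context {R : realType} (n : nat).

Lemma derive_gradient (F : 'cV[R]_n -> R) z v :
  differentiable F z -> 'D_v F z = dot (gradient F z) v.
Proof.
move=> dF; rewrite deriveE // {1}(matrix_sum_delta v) linear_sum dotE.
apply: eq_bigr => i _; rewrite big_ord1 linearZ /= mxE deriveE //.
by rewrite mulrC.
Qed.

Lemma derive_ge0_of_min (F : 'cV[R]_n -> R) z v :
  differentiable F z -> (forall h, F z <= F (h *: v + z)) -> 0 <= 'D_v F z.
Proof.
move=> dF Fmin; have cv : derivable F z v by exact: diff_derivable.
have cvr := cvg_dnbhs_at_right cv.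
rewrite /derive -(cvg_lim _ cvr) //.
apply: limr_ge; first exact: cvgP cvr.
near=> h.
have h0 : 0 < h by near: h; exact: nbhs_right_gt.
change (0 <= h^-1 * (F (h *: v + z) - F z)).
by rewrite mulr_ge0 ?invr_ge0 ?(ltW h0) // subr_ge0.
Unshelve. all: by end_near. Qed.

(** The one-sided estimate is applied to both [v] and [- v]. *)
Lemma gradient_orthogonal (F : 'cV[R]_n -> R) z v :
  differentiable F z -> (forall h, F z <= F (h *: v + z)) -> dot (gradient F z) v = 0.
Proof.
move=> dF Fmin; rewrite -derive_gradient //; apply/le_anti.
rewrite derive_ge0_of_min // andbT -oppr_ge0.
have -> : - 'D_v F z = 'D_(- v) F z by rewrite !derive_gradient // dotNr.
apply: derive_ge0_of_min => // h; rewrite scalerN -scaleNr; exact: Fmin.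
Qed.

End FirstOrder.

(** * KKT matrices *)

Section Selection.
Context {R : realType} (n : nat) (D : {set 'I_n}).
Local Notation P := (chi R D).

Lemma chi_mulE q (B : 'M[R]_(n, q)) k l : (P *m B) k l = B (enum_val k) l.
Proof.
rewrite mxE (bigD1 (enum_val k)) //= mxE eqxx mul1r big1 ?addr0 // => j jk.
by rewrite mxE eq_sym (negbTE jk) mul0r.
Qed.

Lemma mul_chi_trE q (B : 'M[R]_(q, n)) k l : (B *m P^T) k l = B k (enum_val l).
Proof. by rewrite -{1}[B]trmxK -trmx_mul [LHS]mxE chi_mulE mxE. Qed.

Lemma chi_mul_tr : P *m P^T = 1%:M.
Proof.
by apply/matrixP => k l; rewrite chi_mulE !mxE (inj_eq enum_val_inj) eq_sym.
Qed.

Lemma chi_tr_enum_val (u : 'cV[R]_#|D|) k : (P^T *m u) (enum_val k) 0 = u k 0.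
Proof. by rewrite -chi_mulE mulmxA chi_mul_tr mul1mx. Qed.

Lemma chi_tr_notin (u : 'cV[R]_#|D|) i : i \notin D -> (P^T *m u) i 0 = 0.
Proof.
move=> iD; rewrite mxE big1 // => k _; rewrite !mxE.
case: eqP => [ki|]; last by rewrite mul0r.
by move: iD; rewrite -ki enum_valP.
Qed.

Lemma IprojE (u : 'cV[R]_n) i : (Iproj R D *m u) i 0 = (i \in D)%:R * u i 0.
Proof.
rewrite /Iproj -mulmxA; case: (boolP (i \in D)) => iD; last first.
  by rewrite chi_tr_notin // mul0r.
by rewrite -(enum_rankK_in iD iD) chi_tr_enum_val chi_mulE mul1r.
Qed.

Lemma enorm_chi_tr (u : 'cV[R]_#|D|) : enorm (P^T *m u) = enorm u.
Proof. by rewrite /enorm dot_mul trmxK mulmxA chi_mul_tr mul1mx. Qed.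

Lemma enorm_chi (u : 'cV[R]_n) : enorm (P *m u) <= enorm u.
Proof.
have [/eqP u0|u0] := boolP (enorm (P *m u) == 0); first by rewrite u0 enorm_ge0.
have u1 : 0 < enorm (P *m u) by rewrite lt_neqAle eq_sym u0 enorm_ge0.
rewrite -(ler_pM2l u1) -expr2 sqr_enorm dot_mul.
apply: le_trans (ler_norm _) _; apply: le_trans (dot_CS _ _) _.
by rewrite enorm_chi_tr mulrC.
Qed.

End Selection.

Lemma submatE (R : realType) p q (A : 'M[R]_(p, q)) (K : {set 'I_p}) (D : {set 'I_q}) :
  submat A K D = chi R K *m A *m (chi R D)^T.
Proof. by apply/matrixP => k l; rewrite mul_chi_trE chi_mulE mxE. Qed.

Lemma lowner_le_dot (R : realType) n (B C : 'M[R]_n) u :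
  lowner_le B C -> dot u (B *m u) <= dot u (C *m u).
Proof.
by case=> _ /(_ u); rewrite -mulmxA -/(dot _ _) mulmxBl dotBr subr_ge0.
Qed.

Lemma gwidth_eq0 (R : realType) (V : finType) (e : rel V) p q
    (rI : 'I_p -> V) (cI : 'I_q -> V) (B : 'M[R]_(p, q)) (w : nat) k l :
  gwidth e rI cI B <= w%:R -> (w < gdist e (rI k) (cI l))%N -> B k l = 0.
Proof.
move=> Bw wkl; have /inf_lt : gwidth e rI cI B < (gdist e (rI k) (cI l))%:R.
  by apply: le_lt_trans Bw _; rewrite ltr_nat.
case=> [|y [_ /(_ k l)]]; last by [].
(* The set of admissible widths is non-empty: the sum of all distances is exceeded by none of
   them. *)
exists (\sum_k \sum_l (gdist e (rI k) (cI l))%:R); split.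
  by rewrite sumr_ge0 // => ? _; rewrite sumr_ge0.
move=> k' l'; rewrite (bigD1 k') //= (bigD1 l') //= -addrA gtrDl => h.
suff : (0 : R) < 0 by rewrite ltxx.
apply: le_lt_trans h; rewrite addr_ge0 ?sumr_ge0 // => ? _.
by rewrite sumr_ge0.
Qed.

Lemma unitmx_of_injective (R : realType) n (M : 'M[R]_n) :
  (forall u : 'cV_n, M *m u = 0 -> u = 0) -> M \in unitmx.
Proof.
move=> Minj; rewrite -unitmx_tr -row_free_unit -kermx_eq0; apply/eqP/row_matrixP => i.
rewrite row0 -[LHS]trmxK [(row i _)^T]Minj ?trmx0 //.
by apply: trmx_inj; rewrite trmx_mul trmxK -row_mul mulmx_ker row0 trmx0.
Qed.

Lemma enorm_col_mxD (R : realType) p q (u : 'cV[R]_p) (v : 'cV[R]_q) :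
  enorm (col_mx u v) <= enorm u + enorm v.
Proof.
rewrite -(@ler_pXn2r _ 2) ?nnegrE ?addr_ge0 ?enorm_ge0 //.
rewrite sqr_enorm dot_col_mx sqrrD !sqr_enorm.
by rewrite addrAC lerDl mulrn_wge0 // mulr_ge0 // enorm_ge0.
Qed.

Section KKT.
Context {R : realType} (p q : nat) (J : 'M[R]_p) (A : 'M[R]_(q, p)) (c L a c2 : R).
Hypotheses (c_gt0 : 0 < c) (L_gt0 : 0 < L) (a_ge0 : 0 <= a) (c2_gt0 : 0 < c2).
Hypotheses (Jsym : J^T = J).
Hypotheses (Jge : forall u, c * dot u u <= dot u (J *m u)).
Hypotheses (Jle : forall u, dot u (J *m u) <= L * dot u u).
Hypotheses (Ale : forall u, enorm (A *m u) <= a * enorm u).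
Hypotheses (Atle : forall v, enorm (A^T *m v) <= a * enorm v).
Hypotheses (Atge : forall v, c2 ^+ 2 * dot v v <= dot (A^T *m v) (A^T *m v)).

Definition kkt_mx : 'M[R]_(p + q) := block_mx J A^T A 0.

Lemma kkt_mx_mul (u : 'cV_p) (v : 'cV_q) :
  kkt_mx *m col_mx u v = col_mx (J *m u + A^T *m v) (A *m u).
Proof. by rewrite mul_block_col mul0mx addr0. Qed.

Lemma kkt_mx_sym : kkt_mx^T = kkt_mx.
Proof. by rewrite tr_block_mx Jsym trmxK trmx0. Qed.

Lemma enorm_le_sym_le u : enorm (J *m u) <= L * enorm u.
Proof.
have L0 := L_gt0; apply: sym_enorm_le => // [|w]; first exact: ltW.
rewrite ger0_norm //; apply: le_trans (Jge w).
by rewrite mulr_ge0 ?dot_ge0 // ltW.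
Qed.

(** The diagonal part contributes [L]; the off-diagonal part exchanges the blocks and contributes
    [a]. *)
Lemma kkt_mx_le u : enorm (kkt_mx *m u) <= (L + a) * enorm u.
Proof.
rewrite -[u]vsubmxK; move: (usubmx u) (dsubmx u) => {u} u v.
rewrite kkt_mx_mul.
have -> : col_mx (J *m u + A^T *m v) (A *m u) =
    col_mx (J *m u) (0 : 'cV_q) + col_mx (A^T *m v) (A *m u).
  by rewrite add_col_mx add0r.
apply: le_trans (enormD _ _) _; rewrite mulrDl lerD //.
  apply: le_trans (enorm_col_mxD _ _) _; rewrite enorm0 addr0.
  apply: le_trans (enorm_le_sym_le u) _; rewrite ler_pM2l //.
  by rewrite ler_sqrt ?dot_ge0 // dot_col_mx lerDl dot_ge0.
apply: enorm_le => //; rewrite !dot_col_mx addrC mulrDr lerD //.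
  by apply: dot_le_of_enorm_le.
by apply: dot_le_of_enorm_le.
Qed.

(** Positivity of the form of [J] at [u - L^-1 *: (J *m u)], with the upper bound on [J] used at
    [J *m u]. *)
Lemma sym_cocoercive u : dot (J *m u) (J *m u) <= L * dot u (J *m u).
Proof.
have L0 := L_gt0.
have sw : dot (J *m u) (J *m u) = dot u (J *m (J *m u)) by rewrite dot_mul Jsym.
have h1 : 0 <= dot (u - L^-1 *: (J *m u)) (J *m (u - L^-1 *: (J *m u))).
  by apply: le_trans (Jge _); rewrite mulr_ge0 ?dot_ge0 // ltW.
have h2 := Jle (J *m u).
move: h1; rewrite mulmxBr -scalemxAr !dotBl !dotBr !dotZl !dotZr -sw.
set x := dot (J *m u) (J *m u) in h2 *; set y := dot u _; set z := dot _ _ in h2 *.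
have h3 : L^-1 * (L^-1 * z) <= L^-1 * x.
  rewrite ler_pM2l ?invr_gt0 // -(ler_pM2l L0) mulVKf ?gt_eqF //.
move=> h1; have h4 : L^-1 * x <= y by lra.
by rewrite -ler_pdivrMl.
Qed.

(** Block elimination. Each of the two triangular factors costs [1 + a / c]; inverting the diagonal
    blocks, [J] and the Schur complement [- A J^-1 A^T], costs the maximum. *)
Lemma kkt_mx_ge u :
  enorm u <= ((c + a) / c) ^+ 2 * Num.max (1 / c) (L / c2 ^+ 2) * enorm (kkt_mx *m u).
Proof.
have [c0 L0 a0 c20] := And4 c_gt0 L_gt0 a_ge0 c2_gt0.
rewrite -[u]vsubmxK; move: (usubmx u) (dsubmx u) => {u} y v.
rewrite kkt_mx_mul; set f := J *m y + A^T *m v; set g := A *m y.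
have solve_le w : enorm w <= c^-1 * enorm (J *m w).
  have [/eqP w0|w0] := boolP (enorm w == 0).
    by rewrite w0 mulr_ge0 ?enorm_ge0 // invr_ge0 ltW.
  have w1 : 0 < enorm w by rewrite lt_neqAle eq_sym w0 enorm_ge0.
  rewrite ler_pdivlMl // -(ler_pM2l w1) mulrCA -expr2 sqr_enorm.
  by apply: le_trans (Jge w) _; apply: le_trans (ler_norm _) _; apply: dot_CS.
have Ju : J \in unitmx.
  apply: unitmx_of_injective => w Jw; apply: enorm_eq0; apply/le_anti.
  by rewrite enorm_ge0 andbT (le_trans (solve_le w)) // Jw enorm0 mulr0.
pose z := invmx J *m f; have Jz : J *m z = f by rewrite mulKVmx.
pose w := y - z; have Jw : J *m w = - (A^T *m v).
  by rewrite mulmxBr Jz /f opprD addrA subrr sub0r.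
pose h := g - A *m z; have hE : h = A *m w by rewrite mulmxBr.
have zle : enorm z <= c^-1 * enorm f by rewrite -Jz.
have wle : enorm w <= a / c * enorm v.
  apply: le_trans (solve_le w) _; rewrite Jw enormN mulrAC mulrC.
  by rewrite ler_pM2r ?invr_gt0.
(* The chain is [c2^2 |v|^2 <= |A^T v|^2 = |J w|^2 <= L <w, J w> = - L <v, h>]. *)
have vle : enorm v <= L / c2 ^+ 2 * enorm h.
  have [/eqP v0|v0] := boolP (enorm v == 0).
    by rewrite v0 mulr_ge0 ?enorm_ge0 // divr_ge0 ?exprn_ge0 // ltW.
  have v1 : 0 < enorm v by rewrite lt_neqAle eq_sym v0 enorm_ge0.
  rewrite mulrAC ler_pdivlMr ?exprn_gt0 // -(ler_pM2l v1) mulrA -expr2 sqr_enorm.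
  rewrite [leLHS]mulrC; apply: le_trans (Atge v) _.
  have -> : dot (A^T *m v) (A^T *m v) = dot (J *m w) (J *m w).
    by rewrite Jw dotNl dotNr opprK.
  apply: le_trans (sym_cocoercive w) _; rewrite mulrCA ler_pM2l //.
  have -> : dot w (J *m w) = - dot v h.
    by rewrite Jw dotNr hE dotC dot_mul trmxK dotC dotC.
  by apply: le_trans (dot_CS v h); rewrite ler_normr lexx orbT.
set mu := Num.max _ _.
have mu1 : c^-1 <= mu by rewrite -div1r le_max lexx.
have mu2 : L / c2 ^+ 2 <= mu by rewrite le_max lexx orbT.
have mu0 : 0 <= mu by apply: le_trans mu1; rewrite invr_ge0 ltW.
have ac : (c + a) / c = 1 + a / c by rewrite mulrDl mulfV ?gt_eqF.
have ac0 : 0 <= a / c by rewrite divr_ge0 // ltW.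
have ue (x : 'cV[R]_p) (x' : 'cV[R]_q) : enorm x <= enorm (col_mx x x').
  by rewrite ler_sqrt ?dot_ge0 // dot_col_mx lerDl dot_ge0.
have de (x : 'cV[R]_p) (x' : 'cV[R]_q) : enorm x' <= enorm (col_mx x x').
  by rewrite ler_sqrt ?dot_ge0 // dot_col_mx lerDr dot_ge0.
have step1 : enorm (col_mx f h) <= (c + a) / c * enorm (col_mx f g).
  have -> : col_mx f h = col_mx f g - col_mx 0 (A *m z).
    by rewrite opp_col_mx add_col_mx oppr0 addr0.
  apply: le_trans (enormB _ _) _; rewrite ac mulrDl mul1r lerD //.
  apply: le_trans (enorm_col_mxD _ _) _; rewrite enorm0 add0r.
  apply: le_trans (Ale z) _; rewrite -mulrA ler_wpM2l //.
  by apply: le_trans zle _; rewrite ler_pM2l ?invr_gt0.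
have step2 : enorm (col_mx z v) <= mu * enorm (col_mx f h).
  apply: enorm_le => //; rewrite !dot_col_mx mulrDr lerD //; apply: dot_le_of_enorm_le => //.
    by apply: le_trans zle _; rewrite ler_wpM2r ?enorm_ge0.
  by apply: le_trans vle _; rewrite ler_wpM2r ?enorm_ge0.
have step3 : enorm (col_mx y v) <= (c + a) / c * enorm (col_mx z v).
  have -> : col_mx y v = col_mx z v + col_mx w 0.
    by rewrite add_col_mx addr0 /w addrC subrK.
  apply: le_trans (enormD _ _) _; rewrite ac mulrDl mul1r lerD //.
  apply: le_trans (enorm_col_mxD _ _) _; rewrite enorm0 addr0.
  by apply: le_trans wle _; rewrite ler_wpM2l.
have cac : 0 <= (c + a) / c by rewrite ac addr_ge0.
move: ((c + a) / c) cac step1 step3 => al al0 step1 step3.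
apply: le_trans step3 _; rewrite expr2 -!mulrA ler_wpM2l //.
by apply: le_trans step2 _; rewrite mulrCA ler_wpM2l.
Qed.

End KKT.

(** * Local problems *)

Section Kappa.
Context {R : realType} (c1 L1 c2 a : R).
Hypotheses (c1_gt0 : 0 < c1) (c1_lt_L1 : c1 < L1) (c2_gt0 : 0 < c2) (a_ge0 : 0 <= a).

(** Places the spectral interval [[c1, L1]] of [J] inside [[L1 / kappa, L1]], as the positive
    definite estimate requires. *)
Lemma kappa_ge : L1 / c1 <= kappa c1 L1 c2 a.
Proof.
have [c0 cL c20 a0] := And4 c1_gt0 c1_lt_L1 c2_gt0 a_ge0.
have h1 : 1 <= ((c1 + a) / c1) ^+ 2.
  by rewrite exprn_ege1 // ler_pdivlMr // mul1r lerDl.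
have h2 : L1 <= L1 + a by rewrite lerDl.
have h3 : c1^-1 <= Num.max (1 / c1) (L1 / c2 ^+ 2) by rewrite div1r le_max lexx.
rewrite /kappa ler_pM ?invr_ge0 //; [lra|lra|].
by rewrite -[leLHS]mul1r ler_pM //; lra.
Qed.

Lemma kappa_gt1 : 1 < kappa c1 L1 c2 a.
Proof. by apply: lt_le_trans kappa_ge; rewrite ltr_pdivlMr // mul1r. Qed.

(** With [L1 >= c1] and [c2 <= a], [kappa] is at least [(c1 + a)^3 / (c1 a^2)], whose minimum
    [27 / 4] is reached at [a = 2 c1]. *)
Lemma kappa_ge6 : c2 <= a -> 6 <= kappa c1 L1 c2 a.
Proof.
have [c0 cL c20 a0] := And4 c1_gt0 c1_lt_L1 c2_gt0 a_ge0 => ca.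
have a1 : 0 < a by lra.
have h2 : c1 + a <= L1 + a by lra.
have h3 : c1 / a ^+ 2 <= Num.max (1 / c1) (L1 / c2 ^+ 2).
  rewrite le_max; apply/orP; right.
  rewrite ler_pM ?invr_ge0 ?exprn_ge0 ?(ltW c0) ?(ltW cL) //.
  by rewrite lef_pV2 ?posrE ?exprn_gt0 // lerXn2r ?nnegrE // ltW.
have h : ((c1 + a) / c1) ^+ 2 * (c1 + a) * (c1 / a ^+ 2) <= kappa c1 L1 c2 a.
  have s0 : 0 <= ((c1 + a) / c1) ^+ 2 by exact: sqr_ge0.
  rewrite /kappa ler_pM ?mulr_ge0 ?divr_ge0 ?invr_ge0 ?exprn_ge0 ?addr_ge0 ?(ltW c0) //.
  by rewrite ler_wpM2l.
apply: le_trans h.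
have -> : ((c1 + a) / c1) ^+ 2 * (c1 + a) * (c1 / a ^+ 2) = (c1 + a) ^+ 3 / (c1 * a ^+ 2).
  by field; rewrite !gt_eqF.
rewrite ler_pdivlMr ?mulr_gt0 ?exprn_gt0 //.
(* The inequality follows from [(c1 + a)^3 - 6 c1 a^2 = a (a - 3/2 c1)^2 + 3/4 a c1^2 + c1^3]. *)
have : 0 <= (a + c1) * (a - 2 * c1) ^+ 2 by rewrite mulr_ge0 ?sqr_ge0 //; lra.
have : 0 <= c1 ^+ 3 by rewrite exprn_ge0 // ltW.
have : 0 <= a * (a - 3 / 2 * c1) ^+ 2 by rewrite mulr_ge0 ?sqr_ge0.
have : 0 <= a * c1 ^+ 2 by rewrite mulr_ge0 ?sqr_ge0.
rewrite !exprS !expr0; lra.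
Qed.

End Kappa.

Section LocalDecay.
Context {R : realType} (N : nat) (e : rel 'I_N).
Hypotheses (e_conn : connected_graph e) (e_sym : symmetric e).
Context (c1 L1 c2 t : R) (m k0 : nat).
Hypotheses (c1_gt0 : 0 < c1) (c1_lt_L1 : c1 < L1) (c2_gt0 : 0 < c2).
Hypotheses (t_gt0 : 0 < t) (m_gt0 : (0 < m)%N) (k0_gt1 : (1 < k0)%N).
Context (J : 'M[R]_N) (W : {set 'I_N}) (A : 'M[R]_(#|W|, N)) (DR : {set 'I_N}).
Hypotheses (J_sym : J^T = J).
Hypotheses (J_ge : forall u, c1 * dot u u <= dot u (J *m u)).
Hypotheses (J_le : forall u, dot u (J *m u) <= L1 * dot u u).
Hypotheses (J_band : forall i j, (2 * m < gdist e i j)%N -> J i j = 0).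
Hypotheses (A_band : forall k j, (2 * m < gdist e (enum_val k) j)%N -> A k j = 0).
Let K := row_support A DR.
Let Al := submat A K DR.
Hypotheses (A_stable : forall v, c2 ^+ 2 * dot v v <= dot (Al^T *m v) (Al^T *m v)).
Let kap := kappa c1 L1 c2 (opnorm A).
Hypothesis rateE : (kap ^+ 2 - 1) / (kap ^+ 2 + 1) = expR (- (4 * m%:R * t)).
Local Notation P := (chi R DR).
Let JD := P *m J *m P^T.

Definition local_kkt : 'M[R]_(#|DR| + #|K|) := kkt_mx JD Al.

Definition local_rhs j : 'cV[R]_(#|DR| + #|K|) :=
  col_mx (P *m col j J) (chi R K *m col j A).

(** A multiplier sits at the vertex of its constraint: the inner [enum_val] selects a row of [A],
    the outer one the vertex of [W] indexing it. *)
Definition local_label (i : 'I_(#|DR| + #|K|)) : 'I_N :=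
  match fintype.split i with inl k => enum_val k | inr k => enum_val (enum_val k) end.

Let L1_gt0 : 0 < L1. Proof. exact: lt_trans c1_lt_L1. Qed.

Let dotP (u : 'cV_#|DR|) : dot u u = dot (P^T *m u) (P^T *m u).
Proof. by rewrite -!sqr_enorm enorm_chi_tr. Qed.

Let dotJD (u : 'cV_#|DR|) : dot u (JD *m u) = dot (P^T *m u) (J *m (P^T *m u)).
Proof. by rewrite dot_mul trmxK /JD !mulmxA. Qed.

Let JD_sym : JD^T = JD.
Proof. by rewrite /JD !trmx_mul trmxK J_sym mulmxA. Qed.

Let JD_ge u : c1 * dot u u <= dot u (JD *m u).
Proof. by rewrite dotP dotJD. Qed.

Let JD_le u : dot u (JD *m u) <= L1 * dot u u.
Proof. by rewrite dotP dotJD. Qed.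

Let Al_le u : enorm (Al *m u) <= opnorm A * enorm u.
Proof.
rewrite /Al submatE -!mulmxA; apply: le_trans (enorm_chi _ _) _.
by apply: le_trans (opnorm_le _ _) _; rewrite enorm_chi_tr.
Qed.

Let Alt_le v : enorm (Al^T *m v) <= opnorm A * enorm v.
Proof.
rewrite /Al submatE !trmx_mul trmxK -!mulmxA; apply: le_trans (enorm_chi _ _) _.
by apply: le_trans (opnorm_trmx_le _ _) _; rewrite enorm_chi_tr.
Qed.

Lemma local_kkt_sym : local_kkt^T = local_kkt.
Proof. exact: kkt_mx_sym. Qed.

Lemma local_kkt_ge (u : 'cV_(#|DR| + #|K|)) :
  (L1 + opnorm A) * enorm u <= kap * enorm (local_kkt *m u).
Proof.
have a0 := opnorm_ge0 A.
have := kkt_mx_ge c1_gt0 L1_gt0 a0 c2_gt0 JD_sym JD_ge JD_le Al_le Alt_le A_stable u.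
move/(ler_wpM2l (addr_ge0 (ltW L1_gt0) a0)) => h; apply: le_trans h _.
by rewrite /kap /kappa !mulrA [_ * (L1 + _)]mulrC !mulrA.
Qed.

Lemma local_kkt_banded : banded e local_label (2 * m) local_kkt.
Proof.
move=> i l; rewrite -(fintype.splitK i) -(fintype.splitK l) /local_label !unsplitK.
case: (fintype.split i) => i'; case: (fintype.split l) => l' /= h.
- by rewrite block_mxEul mul_chi_trE chi_mulE J_band.
- by rewrite block_mxEur !mxE A_band // gdistC.
- by rewrite block_mxEdl mxE A_band.
- by rewrite block_mxEdr mxE.
Qed.

Lemma local_rhs_supp j : supp_within e local_label j (2 * m) (local_rhs j).
Proof.
move=> i; rewrite -(fintype.splitK i) /local_label !unsplitK.
case: (fintype.split i) => i' /= h.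
- by rewrite col_mxEu chi_mulE mxE J_band.
- by rewrite col_mxEd chi_mulE mxE A_band.
Qed.

Lemma enorm_delta j : enorm (delta_mx j 0 : 'cV[R]_N) = 1.
Proof.
rewrite /enorm dotE (bigD1 j) //= !mxE !eqxx mulr1 big1 ?addr0 ?sqrtr1 //.
by move=> i ij; rewrite !mxE (negbTE ij) mul0r.
Qed.

Lemma local_rhs_norm j : enorm (local_rhs j) <= L1 + opnorm A.
Proof.
apply: le_trans (enorm_col_mxD _ _) _; rewrite !colE lerD //.
  apply: le_trans (enorm_chi _ _) _; rewrite -[leRHS]mulr1 -(enorm_delta j).
  exact: enorm_le_sym_le c1_gt0 L1_gt0 J_sym J_ge J_le _.
apply: le_trans (enorm_chi _ _) _; rewrite -[leRHS]mulr1 -(enorm_delta j).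
exact: opnorm_le.
Qed.

Lemma local_kkt_unit : local_kkt \in unitmx.
Proof.
apply: unitmx_of_injective => u Mu; apply/enorm_eq0/le_anti.
have B0 : 0 < L1 + opnorm A by rewrite ltr_pwDl // opnorm_ge0.
rewrite enorm_ge0 andbT -(ler_pM2l B0) mulr0; apply: le_trans (local_kkt_ge _) _.
by rewrite Mu enorm0 mulr0.
Qed.

Lemma local_decay (j : 'I_N) (k : 'I_#|DR|) : j \notin DR ->
  (k0 <= gdist e (enum_val k) j)%N -> k0.+1%:R <= expR (t * k0.+1%:R) ->
  `|usubmx (invmx local_kkt *m local_rhs j) k 0| <=
    expR (- t * (gdist e (enum_val k) j).+1%:R).
Proof.
move=> jDR hk k0e; have a0 := opnorm_ge0 A.
have kap1 : 1 < kap by exact: kappa_gt1.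
have kap0 : 0 < kap := lt_trans ltr01 kap1.
have Mg := mulKVmx local_kkt_unit (local_rhs j).
move: (invmx _ *m _) Mg => g Mg; rewrite mxE.
set rho := gdist e (enum_val k) j in hk *.
have labk : local_label (lshift _ k) = enum_val k.
  by rewrite /local_label -[lshift _ k]/(unsplit (inl k)) unsplitK.
have rho0 : (0 < rho)%N by apply: leq_trans hk; exact: ltnW.
have gsupp : supp_within e local_label j (2 * m) (local_kkt *m g).
  by rewrite Mg; exact: local_rhs_supp.
(* Without constraints the system reduces to [JD] and is positive definite. *)
have [K0|K0] := posnP #|K|.
  have K0v (v : 'cV[R]_#|K|) : v = 0.
    by apply/matrixP => i; have := ltn_ord i; rewrite {2}K0.
  have M2 : (0 < 2 * m)%N by rewrite muln_gt0.
  (* The number of iterations is the largest [N] with [2 m N < rho]. *)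
  have hN : (2 * m * ((rho.-1) %/ (2 * m)) < rho)%N.
    by rewrite mulnC (leq_ltn_trans (leq_trunc_div _ _)) // prednK.
  have hR : (rho <= 2 * m * ((rho.-1) %/ (2 * m)).+1)%N.
    by rewrite mulnC -{1}(prednK rho0) ltn_ceil.
  have uE (u : 'cV[R]_(#|DR| + #|K|)) : exists y, u = col_mx y 0.
    by exists (usubmx u); rewrite -{1}[u]vsubmxK (K0v (dsubmx u)).
  have Mdot (y : 'cV_#|DR|) :
      dot (col_mx y 0) (local_kkt *m col_mx y 0) = dot y (JD *m y).
    rewrite kkt_mx_mul mulmx0 addr0 (K0v (Al *m y)).
    by rewrite /dot tr_col_mx mul_row_col mulmx0 addr0.
  have Ddot (y : 'cV[R]_#|DR|) : dot (col_mx y (0 : 'cV[R]_#|K|)) (col_mx y 0) = dot y y.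
    by rewrite dot_col_mx /dot mulmx0 [X in _ + X]mxE addr0.
  apply: le_trans _ (absorb_posdef kap1 t_gt0 m_gt0 k0_gt1 rateE k0e hk hR).
  apply: (decay_posdef e_conn (lab := local_label) (j := j) kap1 L1_gt0 local_kkt_sym
    local_kkt_banded _ _ gsupp _); last by rewrite labk; exact: hN.
  - move=> u; have [y ->] := uE u; rewrite Mdot Ddot; apply: le_trans (JD_ge y).
    rewrite ler_wpM2r ?dot_ge0 // ler_pdivrMr ?kap0 //.
    by rewrite mulrC -ler_pdivrMr //; exact: kappa_ge.
  - by move=> u; have [y ->] := uE u; rewrite Mdot Ddot.
  rewrite Mg /local_rhs (K0v (chi R K *m _)).
  set tau := 2 * kap / _.
  have tau0 : 0 <= tau := divr_ge0 (mulr_ge0 (ler0n _ 2) (ltW kap0))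
    (mulr_ge0 (ltW L1_gt0) (addr_ge0 (ltW kap0) ler01)).
  rewrite -[tau]ger0_norm // -enormZ scale_col_mx scaler0.
  apply: le_trans (enorm_col_mxD _ _) _; rewrite enorm0 addr0.
  pose E : 'cV[R]_N := delta_mx j 0.
  (* As [j] is outside [DR], [P *m E = 0], so the source is the restriction of a Richardson step on
     [E]. This bounds it by [(kap - 1) / (kap + 1)], sharper than [tau * L1]. *)
  have -> : tau *: (P *m col j J) = - (P *m (E - tau *: (J *m E))).
    rewrite mulmxBr -scalemxAr colE (_ : P *m E = 0) ?sub0r ?opprK //.
    apply/matrixP => i i'; rewrite chi_mulE !mxE; case: eqP => // ij.
    by move: jDR; rewrite -ij enum_valP.
  rewrite enormN; apply: le_trans (enorm_chi _ _) _.
  rewrite /tau; apply: le_trans (richardson_contraction kap1 L1_gt0 J_sym _ J_le E) _;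
    last by rewrite enorm_delta mulr1.
  move=> u.
  apply: le_trans (J_ge u); rewrite ler_wpM2r ?dot_ge0 // ler_pdivrMr ?kap0 //.
  by rewrite mulrC -ler_pdivrMr //; exact: kappa_ge.
have M8 : (0 < 8 * m)%N by rewrite muln_gt0.
have hN : (8 * m * ((rho.-1) %/ (8 * m)) < rho)%N.
  by rewrite mulnC (leq_ltn_trans (leq_trunc_div _ _)) // prednK.
have hR : (rho <= 8 * m * ((rho.-1) %/ (8 * m)).+1)%N.
  by rewrite mulnC -{1}(prednK rho0) ltn_ceil.
(* A constraint is present, so testing [A_stable] on a non-zero vector gives [c2 <= opnorm A]. *)
have kap6 : 6 <= kap.
  apply: kappa_ge6 => //; pose v : 'cV[R]_#|K| := const_mx 1.
  have v0 : 0 < dot v v.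
    by rewrite dotE (eq_bigr (fun=> 1)) ?sumr_const ?card_ord ?ltr0n // => i _; rewrite !mxE mulr1.
  have := le_trans (A_stable v) (dot_le_of_enorm_le a0 (Alt_le v)).
  by rewrite ler_pM2r // ler_pXn2r ?nnegrE // ltW.
apply: le_trans _ (absorb_indefinite kap1 t_gt0 m_gt0 k0_gt1 rateE k0e kap6 hk hR).
apply: (decay_indefinite e_conn (lab := local_label) (j := j) kap6 _ local_kkt_sym
    local_kkt_banded _ local_kkt_ge gsupp _); last by rewrite labk; exact: hN.
- by rewrite ltr_pwDl.
- exact: kkt_mx_le c1_gt0 L1_gt0 a0 JD_sym JD_ge JD_le Al_le Alt_le.
- by rewrite Mg; exact: local_rhs_norm.
Qed.

(** Superposition: moving the known outer part [eta] to the right-hand side makes the inner part of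
    [zeta] a sum of responses to point sources at the vertices outside [DR]. *)
Lemma local_error_bound (zeta err : 'cV[R]_N) (k : 'I_#|DR|) :
  (forall i, i \notin DR -> zeta i 0 = err i 0) ->
  (forall v, Al *m v = 0 -> dot (P^T *m v) (J *m zeta) = 0) ->
  chi R K *m (A *m zeta) = 0 ->
  (forall j, j \notin DR -> (k0 <= gdist e (enum_val k) j)%N /\
    k0.+1%:R <= expR (t * k0.+1%:R)) ->
  `|zeta (enum_val k) 0| <=
    \sum_(j | j \notin DR) expR (- t * (gdist e (enum_val k) j).+1%:R) * `|err j 0|.
Proof.
move=> zeta_err stat feas far.
have [mu muE] : exists mu, P *m (J *m zeta) = Al^T *m mu.
  by apply: orthogonal_kernel => v /stat; rewrite dotC [in X in _ -> X]dot_mul.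
pose eta : 'cV[R]_N := \sum_(j | j \notin DR) err j 0 *: delta_mx j 0.
have etaE i : eta i 0 = (i \notin DR)%:R * err i 0.
  rewrite /eta summxE; case: (boolP (i \in DR)) => iDR /=.
    rewrite big1 ?mul0r // => j jDR; rewrite !mxE andbT; case: eqP => [ij|]; last by rewrite mulr0.
    by rewrite -ij iDR in jDR.
  rewrite (bigD1 i) //= !mxE !eqxx mulr1 mul1r big1 ?addr0 // => j /andP[_ ji].
  by rewrite !mxE eq_sym (negbTE ji) mulr0.
have zetaE : zeta = P^T *m (P *m zeta) + eta.
  apply/matrixP => i o; rewrite ord1 {o} mulmxA [RHS]mxE etaE -/(Iproj R DR) IprojE.
  by case: (boolP (i \in DR)) => iDR /=; rewrite !(mul0r, mul1r, addr0, add0r) // zeta_err.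
have rhsE j : local_rhs j = col_mx (P *m J) (chi R K *m A) *m delta_mx j 0.
  by rewrite mul_col_mx /local_rhs !colE !mulmxA.
(* Stationarity reads [P J zeta = Al^T mu], hence the sign of the multiplier. *)
have sys : local_kkt *m col_mx (P *m zeta) (- mu) =
    - \sum_(j | j \notin DR) err j 0 *: local_rhs j.
  under eq_bigr do rewrite rhsE scalemxAr.
  rewrite /local_kkt kkt_mx_mul -mulmx_sumr -/eta mul_col_mx opp_col_mx; congr col_mx.
    rewrite mulmxN -muE /JD -!mulmxA -mulmxBr -mulmxBr -mulmxN -mulmxN.
    by rewrite {2}zetaE opprD addrA subrr sub0r.
  rewrite /Al submatE -!mulmxA -[RHS]add0r -feas -mulmxBr -mulmxBr.
  by rewrite {2}zetaE addrK.
have solE : P *m zeta =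
    - \sum_(j | j \notin DR) err j 0 *: usubmx (invmx local_kkt *m local_rhs j).
  rewrite -[LHS](@col_mxKu _ _ #|K| _ _ (- mu)) -[col_mx _ _](mulKmx local_kkt_unit) sys.
  rewrite mulmxN mulmx_sumr linearN linear_sum /=; congr (- _).
  by apply: eq_bigr => j _; rewrite -scalemxAr linearZ.
rewrite -chi_mulE solE mxE normrN summxE; apply: le_trans (ler_norm_sum _ _ _) _.
apply: ler_sum => j jDR; have [f1 f2] := far j jDR.
rewrite mxE normrM mulrC ler_wpM2r //; exact: local_decay.
Qed.

End LocalDecay.

(** * Convergence *)

Section Delta.
Context {R : realType} (N : nat) (e : rel 'I_N) (d D1 k r : R) (m : nat).
Hypotheses (e_conn : connected_graph e) (e_sym : symmetric e).
Hypotheses (d_gt0 : 0 < d) (D1_gt0 : 0 < D1) (growth : polynomial_growth e d D1).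
Hypotheses (m_gt0 : (0 < m)%N) (k_gt1 : 1 < k) (r_ge1 : 1 <= r).

Definition rate : R := 1 / (4 * m%:R) * ln ((k ^+ 2 + 1) / (k ^+ 2 - 1)).

Let k2_gt1 : 0 < k ^+ 2 - 1.
Proof. by rewrite subr_gt0 exprn_egt1. Qed.

Let m4_gt0 : 0 < 4 * m%:R :> R.
Proof. by rewrite mulr_gt0 // ltr0n. Qed.

Let ratio_gt1 : 1 < (k ^+ 2 + 1) / (k ^+ 2 - 1).
Proof. by rewrite ltr_pdivlMr // mul1r; lra. Qed.

Lemma rate_gt0 : 0 < rate.
Proof. by rewrite mulr_gt0 ?ln_gt0 // div1r invr_gt0. Qed.

Lemma rateE : (k ^+ 2 - 1) / (k ^+ 2 + 1) = expR (- (4 * m%:R * rate)).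
Proof.
rewrite /rate div1r mulVKf ?gt_eqF // expRN lnK ?invf_div //.
by rewrite posrE (lt_trans ltr01).
Qed.

Let t := rate.
Let l := Num.truncn r.
Let r0 : 0 <= r. Proof. exact: le_trans r_ge1. Qed.
Let l_le : l%:R <= r. Proof. by have /andP[] := truncn_itv r0. Qed.
Let l_gt : r < l.+1%:R. Proof. by have /andP[] := truncn_itv r0. Qed.

Lemma delta_ge0 : 0 <= delta d D1 m k r.
Proof. by rewrite !mulr_ge0 ?powR_ge0 ?rfact_ge0 // ltW. Qed.

(** The tail sum is taken at the integer radius [l], the integer part of [r]; replacing
    [exp (- t r)] by [exp (- t l)] costs [exp (t (r - l))]. *)
Lemma expR_sum_delta i :
  \sum_j expR (- t * (maxn (gdist e i j) l.+1)%:R) <=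
  delta d D1 m k r * expR (t * (r - l%:R)).
Proof.
apply: le_trans (ball_expR_sum i l d_gt0 D1_gt0 rate_gt0 growth) _.
have -> : delta d D1 m k r = expR (- t * r) * (D1 * rfact d * t `^ (- d) * (r + 2) `^ d).
  rewrite /delta -/t rateE mulrC; congr (_ * _).
  by rewrite -expRM /t; congr expR; field; rewrite pnatr_eq0 -lt0n.
rewrite [leRHS]mulrAC -expRD (_ : - t * r + t * (r - l%:R) = - t * l%:R); last by ring.
rewrite ler_wpM2l ?expR_ge0 // ler_wpM2l //.
  by rewrite !mulr_ge0 ?powR_ge0 ?rfact_ge0 // ltW.
apply: ge0_ler_powR; [exact: ltW|by rewrite nnegrE|by rewrite nnegrE addr_ge0|].
by rewrite -addn2 natrD lerD2r.
Qed.

(** Only the distance matters, not the region containing [i]; the kernel is thus symmetric, and one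
    estimate serves rows and columns. *)
Definition schur_kernel i j : R :=
  if (l < gdist e i j)%N then expR (- t * (gdist e i j).+1%:R) else 0.

Lemma schur_kernel_ge0 i j : 0 <= schur_kernel i j.
Proof. by rewrite /schur_kernel; case: ifP => // _; rewrite expR_ge0. Qed.

Lemma schur_kernelC i j : schur_kernel i j = schur_kernel j i.
Proof. by rewrite /schur_kernel gdistC. Qed.

(** The [+ 1] in the exponent supplies [exp (- t)], which outweighs the rounding loss
    [exp (t (r - l))] because [r < l + 1]. *)
Lemma schur_kernel_sum i : \sum_j schur_kernel i j <= delta d D1 m k r.
Proof.
have t0 : 0 < t by exact: rate_gt0.
apply: le_trans (_ : expR (- t) * (delta d D1 m k r * expR (t * (r - l%:R))) <= _).
  apply: le_trans (ler_wpM2l (expR_ge0 (- t)) (expR_sum_delta i)).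
  rewrite mulr_sumr; apply: ler_sum => j _; rewrite /schur_kernel.
  case: ifP => [lj|_]; last by rewrite mulr_ge0 ?expR_ge0.
  by rewrite (maxn_idPl lj) -expRD ler_expR -natr1; lra.
rewrite mulrCA -[leRHS]mulr1 ler_wpM2l ?delta_ge0 // -expRD -[leRHS]expR0 ler_expR.
have -> : - t + t * (r - l%:R) = t * (r - l.+1%:R) by rewrite -natr1; ring.
by rewrite pmulr_rle0 // subr_le0 ltW.
Qed.

(** The ball of radius [l + 1] has at least [l + 2] vertices, each contributing [exp (- t (l + 1))]
    to the tail sum. With [delta < 1] this gives [l + 2 <= exp (t (r + 1))], and [r < l + 1]. *)
Lemma radius_le_expR i j : delta d D1 m k r < 1 -> (l < gdist e i j)%N ->
  l.+2%:R <= expR (t * l.+2%:R).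
Proof.
move=> delta1 lij; have t0 : 0 < t by exact: rate_gt0.
have card := card_ball_gt e_conn lij.
have : l.+2%:R * expR (- t * l.+1%:R) <= expR (t * (r - l%:R)).
  apply: le_trans (_ : delta d D1 m k r * expR (t * (r - l%:R)) <= _); last first.
    by rewrite -[leRHS]mul1r ler_wpM2r ?expR_ge0 // ltW.
  apply: le_trans (expR_sum_delta i).
  rewrite (bigID [pred v | (gdist e i v <= l.+1)%N]) /=.
  rewrite -[leLHS]addr0 lerD ?sumr_ge0 //.
  rewrite (eq_bigr (fun=> expR (- t * l.+1%:R))); last first.
    by move=> v vl; rewrite (maxn_idPr vl).
  rewrite sumr_const -[leRHS]mulr_natl ler_wpM2r ?expR_ge0 // ler_nat.
  by rewrite cardsE in card.
move/(ler_wpM2r (expR_ge0 (t * l.+1%:R))); rewrite -mulrA -!expRD mulNr addNr expR0 mulr1.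
move=> h; apply: le_trans h _; rewrite ler_expR -mulrDr ler_pM2l //.
by move: l_gt; rewrite -2!natr1; lra.
Qed.

End Delta.

Lemma far_gdist (R : realType) (V : finType) (e : rel V) (r : R) (V1 V2 : {set V}) i j :
  (r%:E < gdist_set R e V1 V2)%E -> i \in V1 -> j \in V2 -> r < (gdist e i j)%:R.
Proof.
move=> rV iV jV; rewrite -lte_fin; apply: lt_le_trans rV _.
by apply: ereal_inf_lbound; exists i, j.
Qed.

Theorem theorem3p1 (R : realType)
  (N : nat) (e : rel 'I_N)
  (e_simple : simple_graph e) (e_connected : connected_graph e)
  (d D1 : R) (d_gt0 : 0 < d) (D1_gt0 : 0 < D1)
  (growth : polynomial_growth e d D1)
  (m : nat) (m_ge1 : (1 <= m)%N)
  (f : 'I_N -> 'cV[R]_N -> R)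
  (f_C1 : forall i, continuously_differentiable (f i))
  (f_local : forall i (x y : 'cV[R]_N),
    (forall j, j \in gball e i (m%:R : R) -> x j 0 = y j 0) -> f i x = f i y)
  (F : 'cV[R]_N -> R) (FE : forall x, F x = \sum_i f i x)
  (c1 L1 : R) (c1_gt0 : 0 < c1) (c1_lt_L1 : c1 < L1)
  (J : 'cV[R]_N -> 'cV[R]_N -> 'M[R]_N)
  (J_posdef : forall x y, posdefmx (J x y))
  (J_width : forall x y, gwidth e id id (J x y) <= (2 * m)%:R)
  (J_ge : forall x y, lowner_le c1%:M (J x y))
  (J_le : forall x y, lowner_le (J x y) L1%:M)
  (J_grad : forall x y, gradient F x - gradient F y = J x y *m (x - y))
  (r : R) (r_ge1 : 1 <= r)
  (Lambda : {set 'I_N}) (D DR : 'I_N -> {set 'I_N})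
  (D_disjoint : forall l l', l \in Lambda -> l' \in Lambda -> l != l' ->
    [disjoint D l & D l'])
  (D_cover : \bigcup_(l in Lambda) D l = [set: 'I_N])
  (D_sub : forall l, l \in Lambda -> D l \subset DR l)
  (DR_far : forall l, l \in Lambda -> (r%:E < gdist_set R e (D l) (~: DR l))%E)
  (W : {set 'I_N}) (A : 'M[R]_(#|W|, N)) (b : 'cV[R]_#|W|)
  (A_width : gwidth e (fun k : 'I_#|W| => enum_val k) id A <= (2 * m)%:R)
  (c2 : R) (c2_gt0 : 0 < c2)
  (A_stable : forall l, l \in Lambda ->
    let Al := submat A (row_support A (DR l)) (DR l) in
    lowner_le (c2 ^+ 2)%:M (Al *m Al^T))
  (xs : 'cV[R]_N)
  (xs_min : is_argmin (fun x : 'cV[R]_N => A *m x = b) F xs)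
  (x : nat -> 'cV[R]_N) (w : nat -> forall l : 'I_N, 'cV[R]_#|DR l|)
  (w_min : forall n l, l \in Lambda ->
    let ext u := (chi R (DR l))^T *m u + Iproj R (~: DR l) *m x n in
    let chiW := chi R (row_support A (DR l)) in
    is_argmin (fun u => chiW *m A *m ext u = chiW *m b) (fun u => F (ext u))
      (w n l))
  (x_step : forall n,
    x n.+1 = \sum_(l in Lambda) Iproj R (D l) *m ((chi R (DR l))^T *m w n l))
  (delta_lt1 : delta d D1 m (kappa c1 L1 c2 (opnorm A)) r < 1) :
  forall (p : \bar R) (n : nat), (1 <= p)%E ->
    lpnorm p (x n - xs) <=
      delta d D1 m (kappa c1 L1 c2 (opnorm A)) r ^+ n * lpnorm p (x 0%N - xs).
Proof.
case: e_simple => e_sym _.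
have a0 := opnorm_ge0 A.
set k := kappa c1 L1 c2 (opnorm A) in delta_lt1 *.
have k1 : 1 < k by exact: kappa_gt1.
pose l := Num.truncn r.
have r0 : 0 <= r by exact: le_trans r_ge1.
have l_le : l%:R <= r by have /andP[] := truncn_itv r0.
have l_gt0 : (0 < l)%N by rewrite truncn_gt0.
have t0 : 0 < rate k m by exact: rate_gt0.
have Fdiff z : differentiable F z.
  have -> : F = \sum_i f i by apply/funext => y; rewrite FE fct_sumE.
  by apply: differentiable_sum => i; have [] := f_C1 i.
pose K := schur_kernel e k r m.
have step n i : `|(x n.+1 - xs) i 0| <= \sum_j K i j * `|(x n - xs) j 0|.
  have /bigcupP[lam lamL iD] : i \in \bigcup_(la in Lambda) D la by rewrite D_cover inE.
  have iDR : i \in DR lam by exact: (fintype.subsetP (D_sub _ lamL)).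
  set P := chi R (DR lam).
  have xE : x n.+1 i 0 = (P^T *m w n lam) i 0.
    rewrite x_step summxE (bigD1 lam) //= IprojE iD mul1r big1 ?addr0 // => la /andP[laL lala].
    rewrite IprojE; case: (boolP (i \in D la)) => iDla; last by rewrite mul0r.
    by have /disjointFr/(_ iDla) := D_disjoint _ _ laL lamL lala; rewrite iD.
  have [/= wfeas wmin] := w_min n lam lamL.
  (* [z] is the local minimiser completed by the old iterate: it has the new value at [i] and the
     old values outside [DR lam]. *)
  pose z := P^T *m w n lam + Iproj R (~: DR lam) *m x n.
  have ziDR j : j \in DR lam -> z j 0 = (P^T *m w n lam) j 0.
    by move=> jDR; rewrite mxE IprojE inE jDR mul0r addr0.
  have zout j : j \notin DR lam -> z j 0 = x n j 0.
    by move=> jDR; rewrite mxE IprojE inE jDR mul1r chi_tr_notin // add0r.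
  pose zeta := z - xs.
  have -> : (x n.+1 - xs) i 0 = zeta i 0 by rewrite mxE xE -ziDR // [RHS]mxE.
  pose Kr := row_support A (DR lam).
  (* Rows outside [Kr] vanish on [DR lam], so a direction feasible for the local problem is feasible
     for the global one. *)
  have APt (v : 'cV[R]_#|DR lam|) : submat A Kr (DR lam) *m v = 0 -> A *m (P^T *m v) = 0.
    rewrite submatE -!mulmxA => Av; apply/matrixP => a o; rewrite ord1 [RHS]mxE {o}.
    case: (boolP (a \in Kr)) => aK.
      by rewrite -(enum_rankK_in aK aK) -chi_mulE Av mxE.
    rewrite mxE big1 // => j _; case: (boolP (j \in DR lam)) => jDR; last first.
      by rewrite chi_tr_notin // mulr0.
    suff -> : A a j = 0 by rewrite mul0r.
    apply/eqP; apply: contraNT aK => Aaj; rewrite inE; apply/existsP; exists j.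
    by rewrite jDR.
  (* Both gradients, at [z] and at [xs], are orthogonal to such directions; [J_grad] rewrites their
     difference. *)
  have stat (v : 'cV[R]_#|DR lam|) :
      submat A Kr (DR lam) *m v = 0 -> dot (P^T *m v) (J z xs *m zeta) = 0.
    move=> Av; have APv := APt v Av.
    rewrite -J_grad dotBr dotC gradient_orthogonal // => [|h]; last first.
      have extE : P^T *m (w n lam + h *: v) + Iproj R (~: DR lam) *m x n =
          h *: (P^T *m v) + z.
        by rewrite mulmxDr -scalemxAr /z addrA; congr (_ + _); rewrite addrC.
      rewrite -extE; apply: wmin; rewrite extE mulmxDr -scalemxAr.
      by rewrite -[X in _ *: X]mulmxA APv mulmx0 scaler0 add0r.
    rewrite dotC gradient_orthogonal ?subr0 // => h; case: xs_min => xsb; apply.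
    by rewrite mulmxDr -scalemxAr APv scaler0 add0r.
  have feas : chi R Kr *m (A *m zeta) = 0.
    rewrite /zeta mulmxBr mulmxBr mulmxA wfeas.
    by case: xs_min => -> _; rewrite subrr.
  have far j : j \notin DR lam -> (l < gdist e i j)%N.
    move=> jDR; rewrite -(ltr_nat R); apply: le_lt_trans l_le _.
    by apply: far_gdist (DR_far _ lamL) iD _; rewrite inE.
  have Jge u : c1 * dot u u <= dot u (J z xs *m u).
    by have := lowner_le_dot u (J_ge z xs); rewrite mul_scalar_mx dotZr.
  have Jle u : dot u (J z xs *m u) <= L1 * dot u u.
    by have := lowner_le_dot u (J_le z xs); rewrite mul_scalar_mx dotZr.
  have Astab (v : 'cV[R]_#|Kr|) : c2 ^+ 2 * dot v v <=
      dot ((submat A Kr (DR lam))^T *m v) ((submat A Kr (DR lam))^T *m v).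
    have := lowner_le_dot v (A_stable lam lamL).
    by rewrite mul_scalar_mx dotZr -mulmxA [X in _ <= X -> _]dotC dot_mul.
  have Jsym : (J z xs)^T = J z xs by case: (J_posdef z xs).
  rewrite -(enum_rankK_in iDR iDR).
  apply: le_trans (local_error_bound e_connected e_sym c1_gt0 c1_lt_L1 c2_gt0 t0 m_ge1
    (k0 := l.+1) _ Jsym Jge Jle (fun i j => gwidth_eq0 (J_width z xs))
    (fun k j => gwidth_eq0 A_width) Astab (rateE m_ge1 k1) (err := x n - xs) _ stat feas _) _.
  - by [].
  - by move=> j jDR; rewrite [LHS]mxE [RHS]mxE zout.
  - rewrite enum_rankK_in // => j jDR; split; first exact: far.
    exact: radius_le_expR delta_lt1 (far j jDR).
  (* Every vertex outside [DR lam] is beyond distance [l], where the kernel equals the local bound;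
     the remaining kernel terms are non-negative. *)
  rewrite enum_rankK_in // [leRHS](bigID [pred j | j \notin DR lam]) /=.
  rewrite -[leLHS]addr0 lerD //; last first.
    by rewrite sumr_ge0 // => j _; rewrite mulr_ge0 ?schur_kernel_ge0.
  by apply: ler_sum => j jDR; rewrite /K /schur_kernel far.
move=> p n p1; elim: n => [|n IHn]; first by rewrite expr0 mul1r.
have d0 : 0 <= delta d D1 m k r by exact: delta_ge0.
rewrite exprS -mulrA; apply: le_trans (ler_wpM2l d0 IHn).
apply: (schur_lpnorm (K := K)) (step n) p1 => //.
- exact: schur_kernel_ge0.
- by move=> i; exact: schur_kernel_sum.
- move=> j; under eq_bigr do rewrite /K schur_kernelC //.
  exact: schur_kernel_sum.
Qed.
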